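(* Let $\mu$ be a translation-invariant, asymptotically decoupled probability measure on $\Omega$, and let $C>0$. Then the following two statements are equivalent (with the same constant $C$): (a) $\bar d(\mu,\nu)\le\sqrt{2C\,s(\nu|\mu)}$ for all translation-invariant probability measures $\nu$ on $\Omega$; (b) $\mu$ satisfies the thermodynamic Gaussian concentration bound with constant $C$: for all $f\in\Delta_1(\Omega)$ the pressure $p(f|\mu)$ exists and $$p(f-\mu(f)\,|\,\mu)\le\frac{C}{2}\|\delta f\|_1^2.$$
   Context: $S$ is a finite set, $d\ge1$, $\Omega=S^{\mathbb{Z}^d}$ with the product of discrete topologies and Borel $\sigma$-algebra; $\mu(f)=\int f\,d\mu$; $\Lambda_n=[-n,n]^d\cap\mathbb{Z}^d$. For $\Lambda\subset\mathbb{Z}^d$, $\mathfrak{F}_\Lambda$ is the $\sigma$-algebra generated by the coordinates $\sigma_i$, $i\in\Lambda$. Shifts: $(\tau_i\eta)_j=\eta_{j-i}$ and $(\tau_i f)(\eta)=f(\tau_i\eta)$; a probability measure is translation invariant if it is invariant under all $\tau_i$. A probability measure $\mu$ is asymptotically decoupled if there exist $g:\mathbb{N}\to\mathbb{N}$ and $c:\mathbb{N}\to[0,\infty)$ with $g(n)/n\to0$ and $c(n)/|\Lambda_n|\to0$ such that for all $j\in\mathbb{Z}^d$, $n\in\mathbb{N}$, $A\in\mathfrak{F}_{\Lambda_n+j}$, $B\in\mathfrak{F}_{(\Lambda_{n+g(n)}+j)^{c}}$: $e^{-c(n)}\mu(A)\mu(B)\le\mu(A\cap B)\le e^{c(n)}\mu(A)\mu(B)$.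 Oscillations: $\delta_i f=\sup\{f(\sigma)-f(\tilde\sigma):\sigma_j=\tilde\sigma_j\ \forall j\ne i\}$, $\|\delta f\|_1=\sum_{i\in\mathbb{Z}^d}\delta_i f$, and $\Delta_1(\Omega)$ is the set of continuous $f:\Omega\to\mathbb{R}$ with $\|\delta f\|_1<\infty$. Pressure: $p(f|\mu)=\lim_{n\to\infty}\frac{1}{|\Lambda_n|}\log\int e^{\sum_{i\in\Lambda_n}\tau_i f}\,d\mu$ (when the limit exists; it exists for every continuous $f$ if $\mu$ is translation invariant and asymptotically decoupled). Relative entropy density: $s_{\Lambda}(\nu|\mu)=\sum_{\sigma\in S^\Lambda}\nu_\Lambda(\sigma)\log\frac{\nu_\Lambda(\sigma)}{\mu_\Lambda(\sigma)}$ if $\nu_\Lambda\ll\mu_\Lambda$ and $+\infty$ otherwise, where $\nu_\Lambda,\mu_\Lambda$ are the marginals on $S^\Lambda$; $s(\nu|\mu)=\lim_{n\to\infty}s_{\Lambda_n}(\nu|\mu)/|\Lambda_n|\in[0,+\infty]$, which exists for every translation-invariant $\nu$ when $\mu$ is translation invariant and asymptotically decoupled. $\bar d(\mu,\nu)=\inf_\Pi\Pi\{\sigma^{(1)}_0\ne\sigma^{(2)}_0\}$, the infimum being over all couplings $\Pi$ of $\mu$ and $\nu$ on $\Omega\times\Omega$ that are invariant under the joint shifts $(\sigma^{(1)},\sigma^{(2)})\mapsto(\tau_i\sigma^{(1)},\tau_i\sigma^{(2)})$, $i\in\mathbb{Z}^d$. *)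

(* Defs.v *)
From HB Require Import structures.
From mathcomp Require Import all_boot all_order all_algebra finmap.
From mathcomp Require Import all_classical all_reals all_analysis.

Set Implicit Arguments.
Unset Strict Implicit.
Unset Printing Implicit Defensive.

Import Order.TTheory GRing.Theory Num.Theory.
Import numFieldNormedType.Exports.

Local Open Scope classical_set_scope.
Local Open Scope ring_scope.

(* The library's measurable types are pointed, so the alphabet is a finite
   nonempty type. An empty alphabet would carry no probability measure on the
   configuration space. *)
#[short(type="pointedFinType")]
HB.structure Definition PointedFinite := {T of Finite T & Pointed T}.

Definition config (S : pointedFinType) (d : nat) : Type :=
  {ptws 'rV[int]_d -> discrete_topology S}.

HB.instance Definition _ (S : pointedFinType) (d : nat) :=
  Topological.on (config S d).
HB.instance Definition _ (S : pointedFinType) (d : nat) :=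
  Pointed.copy (config S d) ('rV[int]_d -> S).
HB.instance Definition _ (S : pointedFinType) (d : nat) :=
  Measurable.copy (config S d) (g_sigma_algebraType (@open (config S d))).

Definition box_set (d n : nat) : set 'rV[int]_d :=
  [set i | forall k, `|i ord0 k| <= n%:Z].

Lemma finite_box_set d n : finite_set (@box_set d n).
Proof.
apply: (@sub_finite_set _ _
  ((fun f : {ffun 'I_d -> 'I_(n.*2.+1)} => \row_k ((f k)%:Z - n%:Z))
     @` [set: {ffun 'I_d -> 'I_(n.*2.+1)}])); last first.
  exact/finite_image/finite_finset.
move=> i hi; exists [ffun k => inord (absz (i ord0 k + n%:Z))] => //.
apply/rowP => k; rewrite mxE ffunE.
have := hi k; rewrite ler_norml => /andP[h1 h2].
have h : 0 <= i ord0 k + n%:Z by rewrite -lerBlDr sub0r.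
rewrite inordK; first by rewrite gez0_abs// addrK.
rewrite ltnS -lez_nat gez0_abs// -addnn PoszD.
by rewrite lerD2r.
Qed.

(* fset_set is only meaningful on finite sets, see finite_box_set. *)
Definition box (d n : nat) : {fset 'rV[int]_d} := fset_set (@box_set d n).

Lemma in_boxE d n : [set` box d n] = @box_set d n.
Proof. exact/fset_setK/finite_box_set. Qed.

Section spin_systems.
Context {R : realType} {S : pointedFinType} {d : nat}.
Local Notation Omega := (config S d).
Local Notation Zd := 'rV[int]_d.

Definition shift (i : Zd) (eta : Omega) : Omega := fun j => eta (j - i).

(* The sigma-algebra generated by the coordinates in L. *)
Definition coord_sigma (L : set Zd) : set (set Omega) :=
  <<s \bigcup_(i in L) preimage_set_system [set: Omega]
        (fun eta : Omega => eta i) [set: set S] >>.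

Definition translation_invariant (mu : probability Omega R) : Prop :=
  forall (i : Zd) (A : set Omega), measurable A -> mu (shift i @^-1` A) = mu A.

Definition translate (L : set Zd) (j : Zd) : set Zd := [set i + j | i in L].

Definition asymptotically_decoupled (mu : probability Omega R) : Prop :=
  exists (g : nat -> nat) (c : nat -> R),
    [/\ forall n, 0 <= c n,
        ((g n)%:R / n%:R : R) @[n --> \oo] --> (0 : R),
        (c n / #|` box d n|%:R) @[n --> \oo] --> (0 : R) &
        forall (j : Zd) (n : nat) (A B : set Omega),
          coord_sigma (translate [set` box d n] j) A ->
          coord_sigma (~` translate [set` box d (n + g n)] j) B ->
          ((expR (- c n))%:E * (mu A * mu B) <= mu (A `&` B))%E /\
          (mu (A `&` B) <= (expR (c n))%:E * (mu A * mu B))%E].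

(* Oscillations are suprema in the extended reals. *)
Definition osc (f : Omega -> R) (i : Zd) : \bar R :=
  ereal_sup [set x | exists sigma tau : Omega,
    (forall j, j != i -> sigma j = tau j) /\ x = (f sigma - f tau)%:E].

Definition osc1 (f : Omega -> R) : \bar R :=
  (\esum_(i in [set: Zd]) osc f i)%E.

Definition Delta1 : set (Omega -> R) :=
  [set f | continuous f /\ (osc1 f < +oo)%E].

Definition mean (mu : probability Omega R) (f : Omega -> R) : R :=
  \int[mu]_eta f eta.

Definition pressure_seq (mu : probability Omega R) (f : Omega -> R)
    (n : nat) : R :=
  (#|` box d n|%:R)^-1 *
  ln (\int[mu]_eta expR (\sum_(i <- box d n) f (shift i eta))).

Definition pressure_exists (mu : probability Omega R) (f : Omega -> R) : Prop :=
  cvgn (pressure_seq mu f).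

Definition pressure (mu : probability Omega R) (f : Omega -> R) : R :=
  limn (pressure_seq mu f).

Definition thermodynamic_gcb (mu : probability Omega R) (C : R) : Prop :=
  forall f : Omega -> R, Delta1 f ->
    pressure_exists mu f /\
    pressure mu (fun eta => f eta - mean mu f) <= C / 2 * (fine (osc1 f)) ^+ 2.

Definition restr (L : {fset Zd}) (eta : Omega) : {ffun L -> S} :=
  [ffun i => eta (val i)].

Definition marginal (L : {fset Zd}) (mu : probability Omega R)
    (B : set {ffun L -> S}) : \bar R := mu (@restr L @^-1` B).

Definition marginal_pmf (L : {fset Zd}) (mu : probability Omega R)
    (sigma : {ffun L -> S}) : R := fine (marginal mu [set sigma]).

(* In the sum, 0 * ln (0 / y) = 0. *)
Definition rel_entropy (L : {fset Zd}) (nu mu : probability Omega R) : \bar R :=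
  if `[< forall B : set {ffun L -> S}, marginal mu B = 0%E ->
           marginal nu B = 0%E >]
  then (\sum_(sigma : {ffun L -> S})
          marginal_pmf nu sigma *
          ln (marginal_pmf nu sigma / marginal_pmf mu sigma))%:E
  else +oo%E.

Definition entropy_density (nu mu : probability Omega R) : \bar R :=
  limn (fun n => (rel_entropy (box d n) nu mu *
                  ((#|` box d n|%:R)^-1)%:E)%E).

Definition joint_shift (i : Zd) (x : Omega * Omega) : Omega * Omega :=
  (shift i x.1, shift i x.2).

Definition invariant_coupling (mu nu : probability Omega R)
    (P : probability (Omega * Omega)%type R) : Prop :=
  [/\ forall A, measurable A -> P (fst @^-1` A) = mu A,
      forall A, measurable A -> P (snd @^-1` A) = nu A &
      forall (i : Zd) (A : set (Omega * Omega)), measurable A ->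
        P (joint_shift i @^-1` A) = P A].

Definition dbar (mu nu : probability Omega R) : \bar R :=
  ereal_inf [set P [set x : Omega * Omega | x.1 0 <> x.2 0]
            | P in invariant_coupling mu nu].

End spin_systems.

(* Main.v *)
Require Import Defs.
From mathcomp Require Import all_boot all_order all_algebra.
From mathcomp Require Import all_classical all_reals all_analysis.
From HB Require Import structures.
From mathcomp Require Import finmap measurable_realfun ring lra zify.
(* MathComp-Analysis also exports a [shift]; this restores the one of [Defs]. *)
Import Defs.

(* Both directions rest on the variational principle
     s(nu|mu) = sup_h (nu(h) - p*(h)),
   where h ranges over local functions and p* is the upper pressure (limsup).
   The lower bound is the finite-volume Donsker-Varadhan inequality; for the
   upper bound one tests with h = log(dnu/dmu) on a box, normalized by
   M = (2n + g(n) + 1)^d, and asymptotic decoupling gives p*(h) <= c(n)/M, by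
   convexity over the M residue classes of translates.

   A tangent functional to p* at a local f is positive, normalized and
   translation invariant, hence an invariant probability nu, and by the
   variational principle it satisfies p*(f) <= nu(f) - s(nu|mu). This makes
   the pressure converge, and together with
   nu(f) - mu(f) <= ||delta f||_1 dbar(mu,nu) <= ||delta f||_1 sqrt(2 C s) it
   gives the concentration bound; a general f in Delta_1 is a uniform limit of
   local functions of no larger oscillation.

   Conversely, optimizing nu(l phi) - p(l phi) <= s(nu|mu) over l > 0 gives
   nu(phi) - mu(phi) <= ||delta phi||_1 sqrt(2 C s) for local phi. Hahn-Banach
   on the local functions of pairs of configurations turns this into an
   invariant coupling: the dual inequality that it needs is Kantorovich duality
   for the normalized Hamming distance on a large box, proved by an infimal
   convolution. *)

Set Implicit Arguments.
Unset Strict Implicit.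
Unset Printing Implicit Defensive.
Import Order.TTheory GRing.Theory Num.Theory.
Import numFieldNormedType.Exports.
Local Open Scope classical_set_scope.
Local Open Scope ring_scope.

(** * The Hahn-Banach theorem for convex functionals *)

(** The limsup is used because convergence of the pressure is itself part of one conclusion. The
    limsup is always available, is still convex and does not increase when a coboundary is added,
    which is what Hahn-Banach needs to produce an invariant functional. Local functions suffice to
    produce measures: local sets are clopen in a compact space, so a positive normalized functional
    on local functions is automatically sigma-additive.

    [M] counts the residue classes of sites modulo [2n + g(n) + 1]. For distinct sites of one class,
    the box of radius [n] around one avoids the box of radius [n + g(n)] around the other, so a
    product over a class factorizes up to [exp(c(n))] per factor. Dividing by [M] instead of
    [|Lambda_n|] costs nothing in the limit, since [g(n)/n -> 0].

    The same [C] serves both ways because [C/2] and [2C] are dual under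
    [a r <= C a^2 / 2 + r^2 / (2C)], with equality at [r = C a]. *)

Section hahn_banach.
Context {R : realType} {V : lmodType R} (L : set V).
Hypothesis L0 : L 0.
Hypothesis LP : forall a x y, L x -> L y -> L (a *: x + y).

Let LD x y : L x -> L y -> L (x + y).
Proof. by move=> Lx Ly; rewrite -[x]scale1r; exact: LP. Qed.

Let LZ a x : L x -> L (a *: x).
Proof. by move=> Lx; rewrite -[_ *: _]addr0; exact: LP. Qed.

Let LN x : L x -> L (- x).
Proof. by rewrite -scaleN1r; exact: LZ. Qed.

Definition sublinear_on (q : V -> R) :=
  (forall x y, L x -> L y -> q (x + y) <= q x + q y) /\
  (forall a x, 0 < a -> L x -> q (a *: x) <= a * q x).

Lemma sublinear_onZ q a x : sublinear_on q -> 0 < a -> L x ->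
  q (a *: x) = a * q x.
Proof.
move=> [_ qZ] a0 Lx; apply/le_anti; rewrite qZ//=.
have := qZ a^-1 (a *: x); rewrite invr_gt0 => /(_ a0 (LZ _ Lx)).
by rewrite scalerA mulVf ?gt_eqF// scale1r mulrC ler_pdivlMr// mulrC.
Qed.

Lemma sublinear_on0 q : sublinear_on q -> q 0 = 0.
Proof.
move=> sq; have := sublinear_onZ sq (ltr0n R 2) L0; rewrite scaler0 => h; lra.
Qed.

Lemma sublinear_onN q x : sublinear_on q -> L x -> - q (- x) <= q x.
Proof.
move=> sq Lx; have := sq.1 x (- x) Lx (LN Lx); rewrite subrr sublinear_on0//; lra.
Qed.

(** Provides the bounds of chains for Zorn's lemma. Each member is bounded below by [- p (- x)], so
    the infimum is finite; comparability lets two near-minimizers, one for each summand, be replaced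
    by the smaller of the two functionals. *)
Lemma chain_inf_sublinear (A : set (V -> R)) (p : V -> R) q0 :
  A q0 -> (forall q, A q -> sublinear_on q /\ forall x, L x -> q x <= p x) ->
  (forall q r, A q -> A r -> (forall x, L x -> q x <= r x) \/
                             (forall x, L x -> r x <= q x)) ->
  sublinear_on (fun x => inf [set q x | q in A]) /\
  forall q x, A q -> L x -> inf [set q x | q in A] <= q x.
Proof.
move=> Aq0 Ap Atot.
have lb x : L x -> has_lbound [set q x | q in A].
  move=> Lx; exists (- p (- x)) => _ [q Aq <-].
  have [sq qp] := Ap _ Aq; apply: le_trans (sublinear_onN sq Lx).
  by rewrite lerN2 qp//; exact: LN.
have hi x : L x -> has_inf [set q x | q in A].
  by move=> Lx; split; [exists (q0 x), q0|exact: lb].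
have inf_le q x : A q -> L x -> inf [set q x | q in A] <= q x.
  by move=> Aq Lx; apply: ge_inf; [exact: lb|exists q].
split => //; split=> [x y Lx Ly|a x a0 Lx].
- apply/ler_addgt0Pr => e e0.
  have e20 : 0 < e / 2 by rewrite divr_gt0.
  have [_ [q Aq <-] hq] := inf_adherent e20 (hi _ Lx).
  have [_ [r Ar <-] hr] := inf_adherent e20 (hi _ Ly).
  have [qr|rq] := Atot _ _ Aq Ar.
  + have := inf_le q (x + y) Aq (LD Lx Ly).
    have := (Ap _ Aq).1.1 x y Lx Ly; have := qr y Ly; lra.
  + have := inf_le r (x + y) Ar (LD Lx Ly).
    have := (Ap _ Ar).1.1 x y Lx Ly; have := rq x Lx; lra.
- rewrite -ler_pdivrMl//; apply: lb_le_inf; first by exists (q0 x), q0.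
  move=> _ [q Aq <-]; rewrite ler_pdivrMl//.
  by apply: le_trans (inf_le q _ Aq (LZ a Lx)) _; apply: (Ap _ Aq).1.2.
Qed.

(* The infimum of [q (x + t y) - t q y] over [t >= 0] is again sublinear, so it
   coincides with a minimal [q], which is therefore additive. *)
Lemma directional_inf_sublinear q y : sublinear_on q -> L y ->
  let r x := inf [set q (x + t *: y) - t * q y | t in [set t | 0 <= t]] in
  sublinear_on r /\ forall x t, L x -> 0 <= t -> r x <= q (x + t *: y) - t * q y.
Proof.
move=> sq Ly r.
have lb x : L x ->
    has_lbound [set q (x + t *: y) - t * q y | t in [set t | 0 <= t]].
  move=> Lx; exists (- q (- x)) => _ [t /= t0 <-].
  have -> : t * q y = q (t *: y).
    move: t0; rewrite le_eqVlt => /predU1P[<-|t0].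
      by rewrite mul0r scale0r sublinear_on0.
    by rewrite sublinear_onZ.
  have := sq.1 (- x) (x + t *: y) (LN Lx) (LD Lx (LZ t Ly)).
  rewrite addKr; lra.
have ne x : [set q (x + t *: y) - t * q y | t in [set t | 0 <= t]] !=set0.
  by exists (q (x + 0 *: y) - 0 * q y), 0 => //=.
have r_le x (t : R) : L x -> 0 <= t -> r x <= q (x + t *: y) - t * q y.
  by move=> Lx t0; apply: ge_inf; [exact: lb|exists t].
split => //; split=> [x z Lx Lz|a x a0 Lx].
- apply/ler_addgt0Pr => e e0.
  have e20 : 0 < e / 2 by rewrite divr_gt0.
  have [_ [t t0 <-] ht] := inf_adherent e20 (conj (ne x) (lb _ Lx)).
  have [_ [s s0 <-] hs] := inf_adherent e20 (conj (ne z) (lb _ Lz)).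
  have := r_le (x + z) (t + s) (LD Lx Lz) (addr_ge0 t0 s0).
  have := sq.1 (x + t *: y) (z + s *: y) (LD Lx (LZ _ Ly)) (LD Lz (LZ _ Ly)).
  rewrite scalerDl addrACA -/(r x) -/(r z) in ht hs *; lra.
- rewrite -ler_pdivrMl//; apply: lb_le_inf => // _ [t /= t0 <-].
  rewrite ler_pdivrMl// (le_trans (r_le _ (a * t) (LZ _ Lx) _))//.
    by rewrite mulr_ge0// ltW.
  rewrite -scalerA -scalerDr sublinear_onZ//; last exact: LD (LZ _ _).
  by rewrite mulrBr mulrA.
Qed.

Lemma hahn_banach_sublinear p : sublinear_on p ->
  exists phi : V -> R,
    (forall a x y, L x -> L y -> phi (a *: x + y) = a * phi x + phi y) /\
    (forall x, L x -> phi x <= p x).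
Proof.
move=> sp.
pose T := {q : V -> R | sublinear_on q /\ forall x, L x -> q x <= p x}.
pose le (q r : T) := `[< forall x, L x -> sval r x <= sval q x >].
pose mk q (sq : sublinear_on q) (qp : forall x, L x -> q x <= p x) : T :=
  exist _ q (conj sq qp).
pose p0 := mk p sp (fun x _ => lexx (p x)).
(* The order [le] is reversed, so a premaximal element is a minimal sublinear functional below
   [p]. *)
have [q qmin] : exists q : T, premaximal le q.
  apply: (ZL_preorder p0).
  - by move=> q; apply/asboolP.
  - move=> r s t /asboolP rs /asboolP st; apply/asboolP => x Lx.
    exact: le_trans (st _ Lx) (rs _ Lx).
  - move=> A Atot; have [[q0 Aq0]|A0] := pselect (A !=set0); last first.
      by exists p0 => s As; exfalso; apply: A0; exists s.
    pose B := [set sval q | q in A].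
    have [|||sB Ble] := @chain_inf_sublinear B p (sval q0); first by exists q0.
    + by move=> _ [q _ <-]; exact: (svalP q).
    + move=> _ _ [q Aq <-] [r Ar <-].
      by have [/asboolP|/asboolP] := Atot _ _ Aq Ar; [right|left].
    have Bp x : L x -> inf [set q x | q in B] <= p x.
      move=> Lx; apply: le_trans ((svalP q0).2 _ Lx).
      by apply: Ble => //; exists q0.
    exists (mk _ sB Bp) => s As; apply/asboolP => x Lx /=.
    by apply: Ble => //; exists s.
have [sq qp] := svalP q.
have qD x y : L x -> L y -> sval q (x + y) = sval q x + sval q y.
  move=> Lx Ly; have [sr r_le] := directional_inf_sublinear sq Ly.
  have r_leq x' : L x' ->
      inf [set sval q (x' + t *: y) - t * sval q y | t in [set t | 0 <= t]]
      <= sval q x'.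
    move=> Lx'; have := r_le x' 0 Lx' (lexx _).
    by rewrite scale0r addr0 mul0r subr0.
  have /asboolP := qmin (mk _ sr (fun x Lx => le_trans (r_leq x Lx) (qp x Lx)))
    (asboolT r_leq).
  move=> /(_ x Lx)/= h; have := r_le x 1 Lx ler01.
  rewrite scale1r mul1r => h'; have := sq.1 _ _ Lx Ly; lra.
have qN x : L x -> sval q (- x) = - sval q x.
  by move=> Lx; have := qD x (- x) Lx (LN Lx); rewrite subrr sublinear_on0//; lra.
exists (sval q); split => // a x y Lx Ly; rewrite qD//; last exact: LZ.
congr (_ + _); have [a0|a0|->] := ltgtP a 0.
- rewrite -[a]opprK scaleNr qN; last exact: LZ.
  by rewrite sublinear_onZ ?oppr_gt0// !mulNr opprK.
- by rewrite sublinear_onZ.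
- by rewrite scale0r mul0r sublinear_on0.
Qed.

(** Reduces to the sublinear case through the infimum over [t > 0] of [p (t x) / t], which is
    positively homogeneous. Convexity along the segment from [t x] to [- s x], which passes through
    0, together with [p 0 = 0] bounds it from below. *)
Lemma hahn_banach_convex p : p 0 = 0 ->
  (forall (t : R) x y, 0 <= t <= 1 -> L x -> L y ->
    p (t *: x + (1 - t) *: y) <= t * p x + (1 - t) * p y) ->
  exists phi : V -> R,
    (forall a x y, L x -> L y -> phi (a *: x + y) = a * phi x + phi y) /\
    (forall x, L x -> phi x <= p x).
Proof.
move=> p0 pcvx.
pose r x := inf [set p (t *: x) / t | t in [set t | 0 < t]].
have p_sym x (t s : R) : L x -> 0 < t -> 0 < s ->
    - (p (s *: (- x)) / s) <= p (t *: x) / t.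
  move=> Lx t0 s0; have ts : 0 < t + s by rewrite addr_gt0.
  have := pcvx (s / (t + s)) (t *: x) (s *: (- x)).
  have -> : 1 - s / (t + s) = t / (t + s) by field; rewrite gt_eqF.
  have -> : (s / (t + s)) *: (t *: x) + (t / (t + s)) *: (s *: - x) = 0.
    by rewrite !scalerA scalerN (mulrAC s) (mulrAC t) [t * s]mulrC subrr.
  rewrite p0.
  have h : 0 <= s / (t + s) <= 1.
    apply/andP; split; first by rewrite divr_ge0// ltW.
      by rewrite ler_pdivrMr// mul1r lerDr ltW.
  move=> /(_ h (LZ _ Lx) (LZ _ (LN Lx))).
  rewrite -[X in 0 <= X](_ : (s * p (t *: x) + t * p (s *: - x)) / (t + s) = _);
    last by field; rewrite gt_eqF.
  rewrite pmulr_lge0 ?invr_gt0// => h'.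
  rewrite -subr_ge0 opprK.
  rewrite (_ : _ + _ = (s * p (t *: x) + t * p (s *: - x)) / (t * s)); last first.
    by field; rewrite !gt_eqF.
  by rewrite divr_ge0// mulr_ge0// ltW.
have lb x : L x -> has_lbound [set p (t *: x) / t | t in [set t | 0 < t]].
  move=> Lx; exists (- (p (1 *: - x) / 1)) => _ [t t0 <-]; exact: p_sym.
have ne x : [set p (t *: x) / t | t in [set t | 0 < t]] !=set0.
  by exists (p (1 *: x) / 1), 1 => //=.
have r_le x (t : R) : L x -> 0 < t -> r x <= p (t *: x) / t.
  by move=> Lx t0; apply: ge_inf; [exact: lb|exists t].
have sr : sublinear_on r.
  split=> [x y Lx Ly|a x a0 Lx].
  - apply/ler_addgt0Pr => e e0.
    have e20 : 0 < e / 2 by rewrite divr_gt0.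
    have [_ [t /= t0 <-] ht] := inf_adherent e20 (conj (ne x) (lb _ Lx)).
    have [_ [s /= s0 <-] hs] := inf_adherent e20 (conj (ne y) (lb _ Ly)).
    have ts : 0 < t + s by rewrite addr_gt0.
    (* The weights [s / (t + s)] and [t / (t + s)] turn [t x] and [s y] into the same multiple of
       [x] and [y], so convexity bounds [p] on a multiple of [x + y]. *)
    have u0 : 0 < t * s / (t + s) by rewrite divr_gt0 ?mulr_gt0.
    have := r_le (x + y) (t * s / (t + s)) (LD Lx Ly) u0.
    have := pcvx (s / (t + s)) (t *: x) (s *: y).
    have -> : 1 - s / (t + s) = t / (t + s) by field; rewrite gt_eqF.
    have h : 0 <= s / (t + s) <= 1.
      apply/andP; split; first by rewrite divr_ge0// ltW.
      by rewrite ler_pdivrMr// mul1r lerDr ltW.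
    move=> /(_ h (LZ _ Lx) (LZ _ Ly)); rewrite !scalerA.
    have -> : s / (t + s) * t = t * s / (t + s) by field; rewrite gt_eqF.
    have -> : t / (t + s) * s = t * s / (t + s) by field; rewrite gt_eqF.
    rewrite -scalerDr => h1 h2.
    have h3 : (s / (t + s) * p (t *: x) + t / (t + s) * p (s *: y)) /
       (t * s / (t + s)) = p (t *: x) / t + p (s *: y) / s.
      by field; rewrite !gt_eqF.
    have {}h1 : p (t * s / (t + s) *: (x + y)) / (t * s / (t + s)) <=
        p (t *: x) / t + p (s *: y) / s.
      by rewrite -h3 ler_pM2r// invr_gt0.
    rewrite -/(r x) -/(r y) in ht hs; lra.
  - rewrite -ler_pdivrMl//; apply: lb_le_inf => // _ [t /= t0 <-].
    rewrite ler_pdivrMl// (le_trans (r_le _ (t / a) (LZ _ Lx) _))//.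
      by rewrite divr_gt0.
    rewrite scalerA divfK ?gt_eqF//.
    by rewrite [X in _ <= X](_ : _ = p (t *: x) / (t / a))//; field; rewrite !gt_eqF.
have [phi [phil phir]] := hahn_banach_sublinear sr.
exists phi; split => // x Lx; apply: le_trans (phir _ Lx) _.
by have := r_le x 1 Lx ltr01; rewrite scale1r divr1.
Qed.
End hahn_banach.

(** * Local functions on the configuration space *)

(** The codomain is an arbitrary type: with [Prop] the notion covers events, so sets and functions
    share their lemmas. *)
Definition depends_on (T : pointedFinType) (d : nat) (L : set 'rV[int]_d) (A : Type)
    (f : config T d -> A) :=
  forall x y, (forall i, L i -> x i = y i) -> f x = f y.

Definition local (T : pointedFinType) (d : nat) (A : Type) (f : config T d -> A) :=
  exists n, depends_on (box_set n) f.

Lemma box_setS d m n : (m <= n)%N -> @box_set d m `<=` @box_set d n.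
Proof. by move=> mn i hi k; apply: le_trans (hi k) _; rewrite lez_nat. Qed.

Definition rad d (j : 'rV[int]_d) : nat := \max_k `|j ord0 k|%N.

Lemma box_set_rad d (j : 'rV[int]_d) : box_set (rad j) j.
Proof.
by move=> k; rewrite -abszE lez_nat; exact: (@leq_bigmax _ (fun k => `|j ord0 k|%N) k).
Qed.

Lemma box_setD d m n (i j : 'rV[int]_d) :
  box_set m i -> box_set n j -> box_set (m + n) (i + j).
Proof.
move=> hi hj k; rewrite mxE PoszD.
by apply: le_trans (ler_normD _ _) _; apply: lerD.
Qed.

Lemma box_setN d n (i : 'rV[int]_d) : box_set n i -> box_set n (- i).
Proof. by move=> hi k; rewrite mxE normrN. Qed.

Lemma in_box d n (i : 'rV[int]_d) : reflect (box_set n i) (i \in box d n).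
Proof. by apply: (iffP idP) => h; [rewrite -in_boxE|move: h; rewrite -in_boxE]. Qed.

Section local_functions.
Context {T : pointedFinType} {d : nat}.
Local Notation Omega := (config T d).
Local Notation Zd := 'rV[int]_d.

Lemma depends_onS (L K : set Zd) A (f : Omega -> A) :
  L `<=` K -> depends_on L f -> depends_on K f.
Proof. by move=> LK fL x y xy; apply: fL => i /LK; exact: xy. Qed.

Lemma depends_on_shift n j A (f : Omega -> A) : depends_on (box_set n) f ->
  depends_on (box_set (n + rad j)) (fun x => f (shift j x)).
Proof.
move=> fn x y xy; apply: fn => i ni; rewrite /shift; apply: xy.
exact/box_setD/box_setN/box_set_rad.
Qed.

Lemma local_shift j A (f : Omega -> A) : local f ->
  local (fun x => f (shift j x)).
Proof. by move=> [n fn]; exists (n + rad j)%N; exact: depends_on_shift. Qed.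

Lemma local_comp A B (g : A -> B) (f : Omega -> A) : local f -> local (fun x => g (f x)).
Proof. by move=> [n fn]; exists n => x y /fn ->. Qed.

Lemma local2 A B C (h : A -> B -> C) (f : Omega -> A) (g : Omega -> B) :
  local f -> local g -> local (fun x => h (f x) (g x)).
Proof.
move=> [n fn] [m gm]; exists (maxn n m) => x y xy.
rewrite (fn x y); last by move=> i ?; apply: xy; exact: box_setS (leq_maxl _ _) _ _.
by rewrite (gm x y)// => i ?; apply: xy; exact: box_setS (leq_maxr _ _) _ _.
Qed.

Lemma local_cst A (a : A) : local (fun _ : Omega => a).
Proof. by exists 0%N. Qed.

Lemma local_sum (R : nmodType) I (s : seq I) (P : pred I) (F : I -> Omega -> R) :
  (forall i, local (F i)) -> local (fun x => \sum_(i <- s | P i) F i x).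
Proof.
move=> lF; elim: s => [|i s ih].
  under eq_fun do rewrite big_nil; exact: local_cst.
under eq_fun do rewrite big_cons; case: (P i) => //.
exact: (local2 (fun a b => a + b)).
Qed.

Lemma shift0 (x : Omega) : shift 0 x = x.
Proof. by apply/funext => j; rewrite /shift subr0. Qed.

Lemma shiftD i j (x : Omega) : shift i (shift j x) = shift (i + j) x.
Proof. by apply/funext => k; rewrite /shift opprD addrA. Qed.

Lemma config_compact : compact [set: Omega].
Proof.
have fin : finite_set [set: discrete_topology T].
  by rewrite -[X in finite_set X](_ : @setT T = _)//; exact: finite_finset.
have := @tychonoff Zd (fun _ => discrete_topology T) (fun=> setT)
  (fun _ => finite_compact fin).
by congr compact; rewrite eqEsubset.
Qed.

Lemma coord_nbhs (x : Omega) i : nbhs x [set y : Omega | x i = y i].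
Proof.
have h := @proj_continuous Zd (fun _ => discrete_topology T) i x.
have hx : nbhs (x : Omega) (@proj Zd (fun _ => discrete_topology T) i @^-1` [set x i]).
  exact/h/discrete_set1.
by move: hx; apply: filterS => y /= h1; exact/esym/h1.
Qed.

Lemma cylinder_nbhs n (x : Omega) :
  nbhs x [set y : Omega | forall i, box_set n i -> x i = y i].
Proof.
have : nbhs x (\bigcap_(i in [set` box d n]) [set y : Omega | x i = y i]).
  by apply: filter_bigI => i _; exact: coord_nbhs.
by apply: filterS => y xy i /in_box; exact: xy.
Qed.

(** Otherwise there are points outside [U] that agree with [x] on larger and larger boxes; they
    converge to [x] coordinatewise, hence in the product topology. *)
Lemma nbhs_cylinder (x : Omega) U : nbhs x U ->
  exists n, [set y : Omega | forall i, box_set n i -> x i = y i] `<=` U.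
Proof.
move=> Ux; apply: contrapT => h.
have {}h n : exists y : Omega, (forall i, box_set n i -> x i = y i) /\ ~ U y.
  apply: contrapT => h'; apply: h; exists n => y xy; apply: contrapT => nU.
  by apply: h'; exists y.
pose y n := projT1 (cid (h n)).
have yP n : (forall i, box_set n i -> x i = y n i) /\ ~ U (y n).
  exact: projT2 (cid (h n)).
have ycvg : (y @ \oo) --> x.
  apply/cvg_sup => i V [W] [[W' oW' <-] WxV WV].
  apply: (filterS WV); rewrite nbhs_simpl; exists (rad i) => // n /= rn.
  rewrite /proj -(yP n).1//.
  exact: box_setS rn _ (box_set_rad i).
have [N _ /(_ N (leqnn N))] := ycvg _ Ux.
exact: (yP N).2.
Qed.

Lemma local_nbhs A (f : Omega -> A) x : local f -> nbhs x [set y | f y = f x].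
Proof.
move=> [n fn]; apply: filterS (cylinder_nbhs n x) => y xy /=.
by apply: fn => i /xy.
Qed.

Lemma local_open (A : set Omega) : local A -> open A.
Proof.
move=> lA; rewrite openE => x Ax; apply: filterS (local_nbhs x lA) => y /= -> //.
Qed.

Lemma local_continuous (U : topologicalType) (f : Omega -> U) :
  local f -> continuous f.
Proof.
move=> lf x V Vx; apply: filterS (local_nbhs x lf) => y /= fyx.
by rewrite /preimage/= fyx; exact: nbhs_singleton.
Qed.

Lemma open_measurable_config (A : set Omega) : open A -> measurable A.
Proof. exact: sub_sigma_algebra. Qed.

Lemma local_measurable (A : set Omega) : local A -> measurable A.
Proof. by move=> /local_open; exact: open_measurable_config. Qed.

(** [F n] collects the points whose cylinder over the box of radius [n] lies in [U]. Countability of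
    the union is what makes the local sets generate the Borel sigma-algebra. *)
Lemma open_local_bigcup (U : set Omega) : open U ->
  exists F : nat -> set Omega, (forall n, local (F n)) /\ U = \bigcup_n F n.
Proof.
move=> oU; exists (fun n => [set x : Omega |
  [set y : Omega | forall i, box_set n i -> x i = y i] `<=` U]); split.
  move=> n; exists n => x y xy; apply/propext; split => h z hz.
    by apply: h => i ni; rewrite xy// hz.
  by apply: h => i ni; rewrite -xy// hz.
apply/seteqP; split => [x Ux|x [n _]]; last exact.
have : nbhs x U by apply: open_nbhs_nbhs.
by move=> /nbhs_cylinder[n hn]; exists n.
Qed.

Lemma measurable_config_local :
  @measurable _ Omega = <<s [set A : set Omega | local A] >>.
Proof.
apply/seteqP; split.
  apply: smallest_sub; first exact: smallest_sigma_algebra.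
  move=> U /open_local_bigcup[F [lF ->]].
  have [_ _] := smallest_sigma_algebra setT [set A : set Omega | local A].
  by apply => n; apply: sub_sigma_algebra; exact: lF.
apply: smallest_sub; first exact: sigma_algebra_measurable.
by move=> A; exact: local_measurable.
Qed.

Lemma local_setI (A B : set Omega) : local A -> local B -> local (A `&` B).
Proof. exact: (local2 and). Qed.

Lemma local_setU (A B : set Omega) : local A -> local B -> local (A `|` B).
Proof. exact: (local2 or). Qed.

Lemma local_setC (A : set Omega) : local A -> local (~` A).
Proof. exact: (local_comp not). Qed.

(** Local sets are clopen and the configuration space is compact. This is the source of
    sigma-additivity for contents on local sets. *)
Lemma local_cover_finite (A : set Omega) (F : nat -> set Omega) :
  local A -> (forall n, local (F n)) -> A `<=` \bigcup_n F n ->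
  exists N, A `<=` \bigcup_(n < N) F n.
Proof.
move=> lA lF AF.
have /compact_near_coveringP := config_compact.
move=> /(_ nat \oo (fun N x => A x -> (\bigcup_(n < N) F n) x) _)[|N _ hN].
  move=> x _; have [Ax|nAx] := pselect (A x); last first.
    near=> y N => /= Ay; exfalso; apply: nAx.
    suff -> : A x = A y by [].
    apply/esym; near: y; exact: local_nbhs.
  have [k _ Fkx] := AF _ Ax.
  near=> y N => _; exists k => /=; first by near: N; exact: nbhs_infty_gt.
  suff -> : F k y = F k x by [].
  by near: y; exact: local_nbhs.
by exists N => x Ax; apply: (hN N) => //=.
Unshelve. all: by end_near. Qed.

End local_functions.

(** * Integrals of continuous functions, and local functions as combinations of cylinders *)

Section integration.
Context {R : realType} {T : pointedFinType} {d : nat}.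
Local Notation Omega := (config T d).
Implicit Types (f g : Omega -> R) (P : probability Omega R).

Lemma continuous_measurable_config f : continuous f -> measurable_fun setT f.
Proof.
move=> cf; apply: (measurability _ (RGenOpens.measurableE R)).
move=> _ [_ [a [b ->] <-]]; rewrite setTI.
apply: open_measurable_config; apply: open_comp; last exact: interval_open.
by move=> x _; exact: cf.
Qed.

Lemma continuous_bounded_config f : continuous f -> exists M, forall x, `|f x| <= M.
Proof.
move=> cf; have : compact (f @` setT).
  by apply: continuous_compact; [exact: continuous_subspaceT|exact: config_compact].
move=> /compact_bounded[M [_ hM]]; exists (M + 1) => x.
by apply: (hM (M + 1)); rewrite ?ltrDl//; exists x.
Qed.

Lemma continuous_integrable P f : continuous f -> P.-integrable setT (EFin \o f).
Proof.
move=> cf; apply: measurable_bounded_integrable => //.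
- exact: le_lt_trans (probability_le1 P measurableT) (ltry _).
- exact: continuous_measurable_config.
- have [M hM] := continuous_bounded_config cf.
  exists M; split; first exact: num_real.
  by move=> x Mx y _ /=; apply: le_trans (hM y) (ltW Mx).
Qed.

Lemma contD f g : continuous f -> continuous g ->
  continuous ((fun x => f x + g x) : Omega -> R).
Proof. by move=> cf cg x; exact: (@cvgD _ _ _ (nbhs x) _ f g _ _ (cf x) (cg x)). Qed.

Lemma contM f g : continuous f -> continuous g ->
  continuous ((fun x => f x * g x) : Omega -> R).
Proof. by move=> cf cg x; exact: (@cvgM _ _ (nbhs x) _ f g _ _ (cf x) (cg x)). Qed.

Lemma cont_cst (a : R) : continuous ((fun=> a) : Omega -> R).
Proof. exact/local_continuous/local_cst. Qed.

Lemma contZ (a : R) f : continuous f -> continuous ((fun x => a * f x) : Omega -> R).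
Proof. by apply: contM; exact: cont_cst. Qed.

Lemma cont_comp (h : R -> R) f : continuous h -> continuous f ->
  continuous ((fun x => h (f x)) : Omega -> R).
Proof. by move=> ch cf x; exact: (@continuous_comp _ _ _ f h x (cf x) (ch _)). Qed.

Lemma cont_sum I (s : seq I) (F : I -> Omega -> R) :
  (forall i, continuous (F i)) ->
  continuous ((fun x => \sum_(i <- s) F i x) : Omega -> R).
Proof.
move=> cF; elim: s => [|i s ih].
  under eq_fun do rewrite big_nil; exact: cont_cst.
by under eq_fun do rewrite big_cons; exact: contD.
Qed.

Lemma mean_lin P a f g : continuous f -> continuous g ->
  mean P (fun x => a * f x + g x) = a * mean P f + mean P g.
Proof.
move=> cf cg; rewrite /mean RintegralD//.
- by rewrite RintegralZl//; exact: continuous_integrable.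
- apply: (@continuous_integrable P (fun x => a * f x)).
  exact: contZ.
- exact: continuous_integrable.
Qed.

Lemma mean_le P f g : continuous f -> continuous g -> (forall x, f x <= g x) ->
  mean P f <= mean P g.
Proof.
by move=> cf cg fg; apply: le_Rintegral => //; exact: continuous_integrable.
Qed.

Lemma mean_cst P a : mean P (fun=> a) = a.
Proof.
rewrite /mean Rintegral_cst// -[RHS]mulr1; congr (_ * _).
exact: (congr1 fine (probability_setT P)).
Qed.

Lemma meanZ P a f : continuous f -> mean P (fun x => a * f x) = a * mean P f.
Proof. by move=> cf; rewrite /mean RintegralZl//; exact: continuous_integrable. Qed.

Lemma meanD P f g : continuous f -> continuous g ->
  mean P (fun x => f x + g x) = mean P f + mean P g.
Proof. by move=> cf cg; rewrite /mean RintegralD//; exact: continuous_integrable. Qed.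

Lemma mean_indic P (A : set Omega) : measurable A -> mean P \1_A = fine (P A).
Proof. by move=> mA; rewrite /mean /Rintegral integral_indic// setIT. Qed.

Lemma local_indic (A : set Omega) : local A -> local (\1_A : Omega -> R).
Proof.
move=> [n An]; exists n => x y xy; rewrite !indicE.
by congr (_%:R); congr nat_of_bool; apply/idP/idP => /set_mem h;
  apply/mem_set; [rewrite -(An x y)|rewrite (An x y)].
Qed.

(** A representative of the cylinder of [s]; a function that depends only on [L] does not see the
    filler [point]. *)
Definition ext_config (L : {fset 'rV[int]_d}) (s : {ffun L -> T}) : Omega :=
  fun i => if insub i is Some j then s j else point.

Lemma depends_on_cylinder (L : {fset 'rV[int]_d}) (s : {ffun L -> T}) :
  depends_on [set` L] (restr L @^-1` [set s] : set Omega).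
Proof.
move=> x y xy; rewrite /preimage/=; congr (_ = _).
by apply/ffunP => i; rewrite !ffunE; apply: xy; exact: valP.
Qed.

Lemma local_fset (L : {fset 'rV[int]_d}) A (f : Omega -> A) :
  depends_on [set` L] f -> local f.
Proof.
move=> fL; exists (\max_(i <- L) rad i)%N; apply: depends_onS fL => i /= iL.
by apply: box_setS (box_set_rad i); exact: (leq_bigmax_seq _ iL).
Qed.

Lemma local_cylinder (L : {fset 'rV[int]_d}) (s : {ffun L -> T}) :
  local (restr L @^-1` [set s] : set Omega).
Proof. exact/local_fset/depends_on_cylinder. Qed.

Lemma depends_on_decomp (L : {fset 'rV[int]_d}) f : depends_on [set` L] f ->
  forall x, f x =
    \sum_(s : {ffun L -> T}) f (ext_config s) * \1_(restr L @^-1` [set s]) x.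
Proof.
move=> fL x; rewrite (bigD1 (restr L x))//= big1 ?addr0; last first.
  move=> s sx; rewrite indicE memNset ?mulr0//= => /eqP.
  by rewrite eq_sym; apply/negP.
rewrite indicE mem_set// mulr1; apply: fL => i /= iL.
by rewrite /ext_config insubT/= ffunE.
Qed.

(** A local function is a finite combination of indicators of cylinders over a box, so a property
    stable under [a f + g] need only be checked on indicators. *)
Lemma local_ind (Q : (Omega -> R) -> Prop) :
  (forall A, local A -> Q \1_A) ->
  (forall a f g, local f -> local g -> Q f -> Q g -> Q (fun x => a * f x + g x)) ->
  forall f, local f -> Q f.
Proof.
move=> Q1 Qlin f [n fn].
rewrite (funext (@depends_on_decomp (box d n) f _)); last first.
  by apply: depends_onS fn => i /in_box.
rewrite unlock /=; elim: (index_enum _) => [|s t ih] /=.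
  (* The empty sum is obtained as [-1 * 1 + 1]. *)
  have := Qlin (-1) _ _ (local_indic (local_cst True)) (local_indic (local_cst True))
     (Q1 _ (local_cst True)) (Q1 _ (local_cst True)).
  by congr Q; apply/funext => x; rewrite mulN1r addNr.
apply: Qlin => //; first exact/local_indic/local_cylinder.
- elim: (t) => [|u v ihv] /=; first exact: local_cst.
  apply: (local2 (fun a b : R => a + b)) => //.
  exact/local_comp/local_indic/local_cylinder.
- exact/Q1/local_cylinder.
Qed.

Lemma mean_cylinders P I (r : seq I) (a : I -> R) (A : I -> set Omega) :
  (forall s, local (A s)) ->
  mean P (fun x => \sum_(s <- r) a s * \1_(A s) x) =
  \sum_(s <- r) a s * fine (P (A s)).
Proof.
move=> lA; elim: r => [|s r ih].
  by under eq_fun do rewrite big_nil; rewrite mean_cst big_nil.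
under eq_fun do rewrite big_cons.
rewrite mean_lin ?ih ?big_cons ?mean_indic//.
- exact: local_measurable.
- exact/local_continuous/local_indic.
- apply/local_continuous/local_sum => i.
  exact: (local_comp (fun u => a i * u) (local_indic _)).
Qed.

(** Local sets form a generating pi-system. [P'] is only a measure, so that it can be a
    pushforward. *)
Lemma probability_local_unique P (P' : {measure set Omega -> \bar R}) :
  (forall A, local A -> P A = P' A) -> forall A, measurable A -> P A = P' A.
Proof.
move=> PP' A mA.
apply: (measure_unique [set A : set Omega | local A] (fun=> setT)) => //.
- exact: measurable_config_local.
- by move=> B C; exact: local_setI.
- by move=> _; exact: local_cst.
- by rewrite bigcup_const.
- by move=> _; exact: le_lt_trans (probability_le1 P measurableT) (ltry _).
Qed.

Lemma shift_continuous j : continuous (@shift T d j).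
Proof.
move=> x U /nbhs_cylinder[n hn].
apply: filterS (cylinder_nbhs (n + rad j) x) => y xy; apply: hn => i ni.
by rewrite /shift; apply: xy; exact/box_setD/box_setN/box_set_rad.
Qed.

Lemma continuous_measurable_map (U : pointedFinType) e (h : Omega -> config U e) :
  continuous h -> measurable_fun setT h.
Proof.
move=> ch; apply: (@measurability _ _ _ _ _ _ (@open (config U e))) => //.
move=> _ [A oA <-]; rewrite setTI; apply: open_measurable_config.
by apply: open_comp => // x _; exact: ch.
Qed.

Lemma mean_shift P j f : translation_invariant P -> continuous f ->
  mean P (fun x => f (shift j x)) = mean P f.
Proof.
move=> Pinv cf; rewrite /mean /Rintegral; congr fine.
have ms : measurable_fun setT (@shift T d j).
  by apply: continuous_measurable_map; exact: shift_continuous.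
have ci : P.-integrable setT (EFin \o (f \o shift j)).
  apply: continuous_integrable => x.
  by apply: continuous_comp; [exact: shift_continuous|exact: cf].
transitivity (\int[pushforward P (shift j)]_x (f x)%:E)%E.
  rewrite (integral_pushforward ms)//.
  by apply/measurable_EFinP; exact: continuous_measurable_config.
by apply: eq_measure_integral => A mA _; exact: Pinv.
Qed.

End integration.

(** * Invariant measures below a convex functional *)

(** A copy of the configuration space whose measurable sets are the local ones. They form an algebra
    of sets, which is the domain for Caratheodory extension, while [config] itself keeps its Borel
    sigma-algebra. *)
Definition local_config (T : pointedFinType) (d : nat) : Type := config T d.

HB.instance Definition _ (T : pointedFinType) (d : nat) :=
  Pointed.copy (local_config T d) (config T d).
HB.instance Definition _ (T : pointedFinType) (d : nat) :=
  isAlgebraOfSets.Build default_measure_display (local_config T d)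
    (local_cst False : @local T d _ set0) (@local_setU T d) (@local_setC T d).

Section extension.
Context {R : realType} {T : pointedFinType} {d : nat}.
Local Notation Omega := (config T d).
Variable phi : (Omega -> R) -> R.
Hypothesis phi_lin : forall a f g, local f -> local g ->
  phi (fun x => a * f x + g x) = a * phi f + phi g.
Hypothesis phi_ge0 : forall f, local f -> (forall x, 0 <= f x) -> 0 <= phi f.
Hypothesis phi1 : phi (fun=> 1) = 1.

(** The value 0 on nonlocal sets is a mere default that makes the content total. *)
Definition local_content (A : set (local_config T d)) : \bar R :=
  if `[< local (A : set Omega) >] then (phi \1_(A : set Omega))%:E else 0%E.

Let local_contentE (A : set Omega) : local A -> local_content A = (phi \1_A)%:E.
Proof. by move=> lA; rewrite /local_content asboolT. Qed.

Let phi0 : phi (fun=> 0) = 0.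
Proof.
have := phi_lin (-1) (local_cst (1 : R)) (local_cst (1 : R)).
by rewrite !mulN1r !addNr.
Qed.

Let local_content0 : local_content set0 = 0%E.
Proof.
rewrite local_contentE ?indic0; last exact: local_cst.
by congr EFin; exact: phi0.
Qed.

Let local_content_ge0 A : (0 <= local_content A)%E.
Proof.
rewrite /local_content; case: asboolP => // lA; rewrite lee_fin phi_ge0//.
exact: local_indic.
Qed.

Let local_contentU (A B : set Omega) : local A -> local B -> A `&` B = set0 ->
  local_content (A `|` B) = (local_content A + local_content B)%E.
Proof.
move=> lA lB AB; rewrite !local_contentE//; last exact: local_setU.
have := phi_lin 1 (@local_indic R _ _ _ lA) (@local_indic R _ _ _ lB).
rewrite mul1r -EFinD => <-; congr (phi _)%:E; apply/funext => x.
rewrite mul1r !indicE in_setU; case: (boolP (x \in A)) => xA; last first.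
  by rewrite add0r.
rewrite memNset ?addr0// => xB.
by have : (A `&` B) x; [split; [exact: set_mem|]|rewrite AB].
Qed.

(** By compactness, a disjoint sequence of local sets with local union has only finitely many
    nonempty terms, so finite additivity is enough. *)
Let local_content_additive : semi_sigma_additive local_content.
Proof.
move=> F mF tF mUF.
have [N UN] := local_cover_finite mUF mF (@subset_refl _ _).
have F0 n : (N <= n)%N -> F n = set0.
  move=> Nn; apply/seteqP; split => // x Fx.
  have [k kN Fkx] := UN x (ex_intro2 _ _ n I Fx).
  have kn : k = n by apply: (tF k n I I); exists x.
  by move: kN; rewrite /= kn ltnNge Nn.
have sumE n : \sum_(0 <= i < n) local_content (F i) =
    local_content (\big[setU/set0]_(i < n) F i).
  elim: n => [|n ih]; first by rewrite big_nil big_ord0 local_content0.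
  rewrite big_nat_recr//= ih big_ord_recr/= local_contentU//.
  - elim: (n) => [|k ihk]; first by rewrite big_ord0; exact: local_cst.
    by rewrite big_ord_recr/=; apply: local_setU => //; exact: mF.
  - exact: mF.
  - rewrite -bigcup_mkord; apply/seteqP; split => // x [[k /= kn Fkx] Fnx].
    have e : k = n by apply: (tF k n I I); exists x.
    by move: kn; rewrite e ltnn.
apply: cvg_near_cst.
exists N => // n /= Nn; rewrite sumE; congr local_content.
rewrite -bigcup_mkord; apply/seteqP; split.
  by move=> x [k _ Fkx]; exists k.
by move=> x /UN[k /= kN Fkx]; exists k => //=; exact: leq_trans Nn.
Qed.

HB.instance Definition _ := isMeasure.Build _ _ _ local_content
  local_content0 local_content_ge0 local_content_additive.

(** The Caratheodory extension lives on the sigma-algebra generated by the local sets; this restates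
    it on the Borel sets, which are the same by [measurable_config_local]. *)
Definition config_extension (A : set Omega) : \bar R :=
  measure_extension local_content A.

Let config_extension_additive : semi_sigma_additive config_extension.
Proof.
move=> F mF tF mUF; rewrite /config_extension.
have h (A : set Omega) : measurable A -> <<s [set A : set Omega | local A] >> A.
  by rewrite measurable_config_local.
have := @measure_semi_sigma_additive _ _ _ (measure_extension local_content) F.
by apply => //; [move=> n; exact: h|exact: h].
Qed.

Let config_extensionT : config_extension setT = 1%E.
Proof.
rewrite /config_extension /measure_extension measurable_mu_extE; last exact: local_cst.
have lT : local ([set: Omega]) := local_cst True.
by rewrite -[RHS](congr1 EFin phi1);
  apply: etrans (local_contentE lT) _; rewrite indicT.
Qed.

HB.instance Definition _ := isMeasure.Build _ _ _ config_extension
  (measure0 (measure_extension local_content))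
  (measure_ge0 (measure_extension local_content)) config_extension_additive.
HB.instance Definition _ := Measure_isProbability.Build _ _ _ config_extension
  config_extensionT.

Lemma riesz_local : exists P : probability Omega R,
  forall f, local f -> mean P f = phi f.
Proof.
exists config_extension; apply: local_ind => [A lA|a f g lf lg fE gE]; last first.
  by rewrite mean_lin ?fE ?gE ?phi_lin//; exact: local_continuous.
rewrite mean_indic; last exact: local_measurable.
rewrite /= /config_extension /measure_extension measurable_mu_extE//.
by have /(congr1 fine)/= <- := local_contentE lA.
Qed.

End extension.

(** The bounds on [p] pass to the functional below it: nonpositive functions give positivity, the
    constants 1 and -1 give total mass 1, and coboundaries give invariance. *)
Lemma invariant_measure_below (R : realType) (T : pointedFinType) (d : nat)
    (p : (config T d -> R) -> R) :
  p (fun=> 0) = 0 ->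
  (forall (t : R) f g, 0 <= t <= 1 -> local f -> local g ->
    p (fun x => t * f x + (1 - t) * g x) <= t * p f + (1 - t) * p g) ->
  (forall f, local f -> (forall x, f x <= 0) -> p f <= 0) ->
  p (fun=> 1) <= 1 -> p (fun=> -1) <= -1 ->
  (forall j f, local f -> p (fun x => f (shift j x) - f x) <= 0) ->
  exists P : probability (config T d) R, translation_invariant P /\
    forall f, local f -> mean P f <= p f.
Proof.
move=> p0 pcvx pneg p1 pN1 pinv.
pose V : lmodType R := (config T d -> R^o).
have [||phi [phil phip]] :=
  @hahn_banach_convex R V [set f : V | local f] _ _ p p0 pcvx.
- exact: local_cst.
- by move=> a f g lf lg; exact: (local2 (fun u v : R => a * u + v)).
have phi0 : phi (fun=> 0) = 0.
  have := phil (-1) (fun=> 0) (fun=> 0) (local_cst _) (local_cst _).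
  have -> : (-1 *: (fun=> 0) + (fun=> 0) : V) = (fun=> 0).
    by apply/funext => x; rewrite !fctE scaler0 addr0.
  by move=> ->; rewrite mulN1r addNr.
have phi_lin a (f g : config T d -> R) : local f -> local g ->
  phi (fun x => a * f x + g x) = a * phi f + phi g by exact: phil.
have phiN (f : config T d -> R) : local f -> phi (fun x => - f x) = - phi f.
  move=> lf; have := phi_lin (-1) f _ lf (local_cst (0 : R)).
  rewrite phi0 addr0 mulN1r => <-; congr phi; apply/funext => x.
  by rewrite mulN1r addr0.
have phi1 : phi (fun=> 1) = 1.
  apply/le_anti; rewrite (le_trans (phip _ (local_cst _)) p1)/=.
  have := phip _ (local_cst (- 1 : R)); rewrite phiN; last exact: local_cst.
  by move=> h; rewrite -lerN2 (le_trans h).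
have phi_ge0 (f : config T d -> R) : local f -> (forall x, 0 <= f x) -> 0 <= phi f.
  move=> lf f0; rewrite -oppr_le0 -phiN//.
  apply: le_trans (phip _ _) (pneg _ _ _); [exact: (local_comp -%R)..|].
  by move=> x; rewrite oppr_le0.
have [P PE] := riesz_local phi_lin phi_ge0 phi1.
exists P; split => [j A mA|f lf]; last by rewrite PE//; exact: phip.
have ms : measurable_fun setT (@shift T d j).
  by apply: continuous_measurable_map; exact: shift_continuous.
suff : forall B : set (config T d), measurable B -> P B = pushforward P (shift j) B.
  by move=> /(_ A mA) ->.
apply: (@probability_local_unique R T d P
  (measure_function_pushforward__canonical__measure_function_Measure P ms)).
move=> B lB; rewrite /= /pushforward.
have lsB : local (shift j @^-1` B) by exact: local_shift.
have fineE (C : set (config T d)) : measurable C -> (fine (P C))%:E = P C.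
  by move=> mC; rewrite fineK// fin_num_measure.
rewrite -fineE; last exact: local_measurable.
rewrite -[RHS]fineE; last exact: local_measurable.
rewrite -!mean_indic; [|exact: local_measurable..].
have lB1 := @local_indic R _ _ _ lB.
rewrite !PE//; last exact: local_indic.
have shiftE : \1_(shift j @^-1` B) = (fun x => \1_B (shift j x)) :> (_ -> R).
  by apply/funext => x; rewrite !indicE.
rewrite shiftE; congr _%:E; apply/esym/eqP; rewrite -subr_eq0; apply/eqP.
have phiB (f : config T d -> R) i : local f -> phi (fun x => f (shift i x)) - phi f <= 0.
  move=> lf; apply: le_trans (pinv i f lf).
  have lD : local (fun x => f (shift i x) - f x).
    by apply: (local2 (fun u v : R => u - v)) => //; exact: local_shift.
  apply: le_trans (phip _ lD).
  have := phi_lin (-1) f _ lf (local_shift i lf).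
  rewrite mulN1r addrC => <-; rewrite le_eqVlt; apply/orP; left; apply/eqP.
  by congr phi; apply/funext => x; rewrite mulN1r addrC.
apply/le_anti; rewrite phiB//=.
(* The reverse inequality comes from shifting the translated indicator back by [- j]. *)
have := phiB (fun x => \1_B (shift j x)) (- j) (local_shift j lB1).
under eq_fun do rewrite shiftD subrr shift0.
by rewrite subr_le0 subr_ge0.
Qed.

(** * Boxes *)

Section boxes.
Context {d : nat}.
Local Notation Zd := 'rV[int]_d.

(* [rowP] states its entries at [0 : 'I_1], which [lia] does not identify with
   [ord0]. *)
Lemma row_eq (i j : Zd) : (forall k, i ord0 k = j ord0 k) -> i = j.
Proof. by move=> ij; apply/rowP => k; exact: ij. Qed.

Definition box_point n (f : {ffun 'I_d -> 'I_(n.*2.+1)}) : Zd :=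
  \row_k ((f k)%:Z - n%:Z).

Lemma box_point_inj n : injective (@box_point n).
Proof.
move=> f g /rowP fg; apply/ffunP => k; apply: val_inj => /=.
by have := fg k; rewrite !mxE => /addIr[].
Qed.

Lemma box_point_in n f : @box_point n f \in box d n.
Proof.
apply/in_box => k; rewrite mxE; have := ltn_ord (f k); lia.
Qed.

Lemma box_point_surj n (i : Zd) : i \in box d n -> exists f, i = @box_point n f.
Proof.
move=> /in_box hi; exists [ffun k => inord (absz (i ord0 k + n%:Z)%R)].
apply: row_eq => k; have := hi k; rewrite mxE ffunE.
by move: (i ord0 k) => a ha; rewrite inordK; lia.
Qed.

Lemma box_perm n : perm_eq (box d n)
  (map (@box_point n) (enum {ffun 'I_d -> 'I_(n.*2.+1)})).
Proof.
apply: uniq_perm; first exact: fset_uniq.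
  by rewrite map_inj_uniq ?enum_uniq//; exact: box_point_inj.
move=> i; apply/idP/mapP => [/box_point_surj[f ->]|[f _ ->]].
  by exists f => //; rewrite mem_enum.
exact: box_point_in.
Qed.

Lemma card_box n : #|` box d n| = (n.*2.+1 ^ d)%N.
Proof.
by rewrite (perm_size (box_perm n)) size_map -cardT card_ffun !card_ord.
Qed.

Lemma card_box_gt0 n : (0 < #|` box d n|)%N.
Proof. by rewrite card_box expn_gt0. Qed.

Lemma sum_sub_bound (R : realType) (I : eqType) (s t : seq I) (h : I -> R) (M : R) :
  uniq s -> uniq t -> {subset s <= t} -> (forall i, `|h i| <= M) ->
  `|\sum_(i <- t) h i - \sum_(i <- s) h i| <= M * (size t - size s)%:R.
Proof.
move=> us ut st hM.
have p : perm_eq t (s ++ [seq i <- t | i \notin s]).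
  apply: uniq_perm => //.
    rewrite cat_uniq us filter_uniq// andbT/=; apply/hasPn => i.
    by rewrite mem_filter => /andP[].
  move=> i; rewrite mem_cat mem_filter; case: (boolP (i \in s)) => [/st ->//|_].
  by [].
rewrite (perm_big _ p)/= big_cat/= addrAC subrr add0r.
rewrite (perm_size p) size_cat addKn.
apply: le_trans (ler_norm_sum _ _ _) _.
apply: (@le_trans _ _ (\sum_(i <- [seq i <- t | i \notin s]) M)).
  by apply: ler_sum => i _.
by rewrite big_const_seq count_predT iter_addr_0 mulr_natr.
Qed.

(** The box and its translate both lie in the box of radius [n + rad j]; comparing each with this
    common superset costs the excess once, hence the factor 2. *)
Lemma box_shift_sum (R : realType) n (j : Zd) (h : Zd -> R) (M : R) :
  (forall i, `|h i| <= M) ->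
  `|\sum_(i <- box d n) h (i + j) - \sum_(i <- box d n) h i| <=
  2 * M * (#|` box d (n + rad j)| - #|` box d n|)%:R.
Proof.
move=> hM.
have inj : injective (fun i : Zd => i + j) by move=> a b /addIr.
have h1 := @sum_sub_bound R _ (box d n) (box d (n + rad j)) h M
  (fset_uniq _) (fset_uniq _) _ hM.
have h2 := @sum_sub_bound R _ [seq i + j | i <- box d n] (box d (n + rad j)) h M
  _ (fset_uniq _) _ hM.
rewrite big_map size_map in h2.
have {}h1 := h1 _; have {}h2 := h2 _ _.
rewrite -mulrA; move: h1 h2; set A := \sum_(_ <- _) _; set B := \sum_(_ <- _) _.
set C := \sum_(_ <- _) _ => h1 h2.
have -> : C - B = (A - B) - (A - C) by ring.
apply: le_trans (ler_normB _ _) _; rewrite mulr_natl mulr2n lerD//.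
  apply: h1 => i /in_box hi; apply/in_box; apply: box_setS hi; exact: leq_addr.
apply: h2.
  by rewrite map_inj_uniq ?fset_uniq.
move=> _ /mapP[i /in_box hi ->]; apply/in_box; apply: box_setD hi _.
exact: box_set_rad.
Qed.

(** The residues of the coordinates modulo [l + 1]. Adding [n] makes the coordinates of a site of
    the box nonnegative, so [absz] changes nothing there. *)
Definition box_class n l (i : Zd) : {ffun 'I_d -> 'I_l.+1} :=
  [ffun k => inord ((absz (i ord0 k + n%:Z)%R) %% l.+1)].

(** Two integers that are congruent modulo [l + 1] and at distance at most [l] are equal. *)
Lemma box_class_sep n l (i j : Zd) : i \in box d n -> j \in box d n ->
  box_class n l i = box_class n l j -> ~ box_set l (i - j) \/ i = j.
Proof.
move=> /in_box hi /in_box hj /ffunP ij.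
have [h|] := pselect (box_set l (i - j)); [right|by left].
apply: row_eq => k; have := ij k; rewrite !ffunE => /(congr1 val)/=.
rewrite !inordK ?ltn_mod//; have := h k; rewrite !mxE.
have := hi k; have := hj k.
move: (i ord0 k) (j ord0 k) => a b.
have ea := divn_eq (absz (a + n%:Z)%R) l.+1; have eb := divn_eq (absz (b + n%:Z)%R) l.+1.
move: ea eb; move: (_ %% _)%N (_ %% _)%N (_ %/ _)%N (_ %/ _)%N => x y u v.
move=> ea eb hb ha hab xy; move: ea eb; rewrite xy => ea eb.
have [uv|vu|uv] := ltngtP u v; last by move: ea eb; rewrite uv; lia.
- have : (u.+1 * l.+1 <= v * l.+1)%N by rewrite leq_mul2r uv orbT.
  by rewrite mulSn; lia.
- have : (v.+1 * l.+1 <= u * l.+1)%N by rewrite leq_mul2r vu orbT.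
  by rewrite mulSn; lia.
Qed.

(** Within a class a site is determined by the quotients of its shifted coordinates by [l + 1], and
    these are at most [2n / (l + 1)]. *)
Lemma size_box_class n l (c : {ffun 'I_d -> 'I_l.+1}) :
  (size [seq i <- box d n | box_class n l i == c] <= (n.*2 %/ l.+1).+1 ^ d)%N.
Proof.
pose q (i : Zd) : {ffun 'I_d -> 'I_(n.*2 %/ l.+1).+1} :=
  [ffun k => inord ((absz (i ord0 k + n%:Z)%R) %/ l.+1)].
set s := [seq i <- box d n | box_class n l i == c].
have inj : {in s &, injective q}.
  move=> i j; rewrite !mem_filter => /andP[/eqP ic ib] /andP[/eqP jc jb] /ffunP qij.
  have /ffunP cij : box_class n l i = box_class n l j by rewrite ic.
  apply: row_eq => k; have := qij k; have := cij k; rewrite !ffunE.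
  move=> /(congr1 val)/= + /(congr1 val)/=.
  have bnd (m : Zd) : m \in box d n -> ((absz (m ord0 k + n%:Z)%R) <= n.*2)%N.
    by move=> /in_box/(_ k); move: (m ord0 k) => a; lia.
  rewrite !inordK ?ltn_mod// ?ltnS ?leq_div2r ?bnd// => e1 e2.
  have : (absz (i ord0 k + n%:Z)%R) = (absz (j ord0 k + n%:Z)%R).
    by rewrite (divn_eq (absz (i ord0 k + _)%R) l.+1) e1 e2 -divn_eq.
  move/in_box/(_ k) : ib; move/in_box/(_ k) : jb.
  by move: (i ord0 k) (j ord0 k) => a b; lia.
have us : uniq (map q s) by rewrite map_inj_in_uniq// filter_uniq// fset_uniq.
rewrite -(size_map q) -(card_uniqP us).
by apply: leq_trans (max_card _) _; rewrite card_ffun !card_ord.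
Qed.

End boxes.

(** * Pressure *)

Section box_asymptotics.
Context {R : realType}.

Lemma cvg_pow_onePD (d : nat) (u : nat -> R) : u n @[n --> \oo] --> (0 : R) ->
  (1 + u n) ^+ d @[n --> \oo] --> (1 : R).
Proof.
move=> u0; have h : 1 + u n @[n --> \oo] --> (1 : R).
  by rewrite -[X in _ --> X]addr0; apply: cvgD => //; exact: cvg_cst.
have := continuous_cvg _ (@exprn_continuous R d 1) h.
by rewrite expr1n; apply.
Qed.

Lemma cvg_cst_odd (a : R) : a / n.*2.+1%:R @[n --> \oo] --> (0 : R).
Proof.
have h : `|a| * n.+1%:R^-1 @[n --> \oo] --> (0 : R).
  by rewrite -[X in _ --> X](mulr0 `|a|); apply: cvgMr; exact: cvg_harmonic.
have hN : - (`|a| * n.+1%:R^-1) @[n --> \oo] --> (0 : R).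
  by rewrite -[X in _ --> X]oppr0; apply: cvgN.
apply: (squeeze_cvgr _ hN h); near=> n; rewrite -ler_norml normrM.
rewrite normfV ler_wpM2l// ger0_norm// lef_pV2 ?posrE//.
by rewrite ler_nat ltnS -addnn leq_addr.
Unshelve. all: by end_near. Qed.

Lemma box_ratio_cvg d r :
  #|` box d (n + r)|%:R / #|` box d n|%:R @[n --> \oo] --> (1 : R).
Proof.
apply: cvg_trans (cvg_pow_onePD d (cvg_cst_odd r.*2%:R)); apply: near_eq_cvg.
near=> n; rewrite !card_box !natrX -exprVn -exprMn; congr (_ ^+ d).
rewrite doubleD -addSn natrD mulrDl divff ?pnatr_eq0//.
Unshelve. all: by end_near. Qed.

Lemma box_excess_cvg d r (a : R) :
  a * (#|` box d (n + r)| - #|` box d n|)%:R / #|` box d n|%:R @[n --> \oo] --> (0 : R).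
Proof.
have h : a * (#|` box d (n + r)|%:R / #|` box d n|%:R - 1) @[n --> \oo] --> (0 : R).
  rewrite -[X in _ --> X](mulr0 a) -[X in a * X](subrr 1); apply: cvgMr.
  by apply: cvgB; [exact: box_ratio_cvg|exact: cvg_cst].
apply: cvg_trans h; apply: near_eq_cvg; near=> n.
have b0 : #|` box d n|%:R != 0 :> R by rewrite pnatr_eq0 -lt0n card_box_gt0.
rewrite natrB; first by rewrite -mulrA mulrBl divff.
apply: uniq_leq_size => [|i /in_box hi]; first exact: fset_uniq.
by apply/in_box; apply: box_setS hi; exact: leq_addr.
Unshelve. all: by end_near. Qed.

End box_asymptotics.

Lemma expR_convex (R : realType) (t u v : R) : 0 <= t <= 1 ->
  expR (t * u + (1 - t) * v) <= t * expR u + (1 - t) * expR v.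
Proof.
move=> /andP[t0 t1].
by have := @convex_expR R (Itv01 t0 t1) u v; rewrite !convRE.
Qed.

Lemma convex_comb_le (R : realType) (t a b u v e : R) : 0 <= t <= 1 ->
  a <= u + e -> b <= v + e -> t * a + (1 - t) * b <= t * u + (1 - t) * v + e.
Proof.
move=> /andP[t0 t1] au bv; have t1' : 0 <= 1 - t by rewrite subr_ge0.
have := ler_wpM2l t0 au; have := ler_wpM2l t1' bv; lra.
Qed.

(** * Finite-volume pressures and their limsup *)

Section pressure.
Context {R : realType} {S : pointedFinType} {d : nat}.
Local Notation Omega := (config S d).
Implicit Types (f g F G : Omega -> R) (mu : probability Omega R).

Definition box_sum n f (x : Omega) : R := \sum_(i <- box d n) f (shift i x).

Definition log_mgf mu F : R := ln (mean mu (fun x => expR (F x))).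

Lemma pressure_seqE mu f n :
  pressure_seq mu f n = (#|` box d n|%:R)^-1 * log_mgf mu (box_sum n f).
Proof. by []. Qed.

Lemma cont_shift j f : continuous f -> continuous ((fun x => f (shift j x)) : Omega -> R).
Proof.
move=> cf x; exact: (@continuous_comp _ _ _ (@shift S d j) f x
  (@shift_continuous S d j x) (cf _)).
Qed.

Lemma cont_box_sum n f : continuous f -> continuous (box_sum n f).
Proof. by move=> cf; apply: cont_sum => i; exact: cont_shift. Qed.

Lemma cont_expR F : continuous F -> continuous ((fun x => expR (F x)) : Omega -> R).
Proof. by apply: cont_comp; exact: continuous_expR. Qed.

Lemma mgf_gt0 mu F : continuous F -> 0 < mean mu (fun x => expR (F x)).
Proof.
move=> cF; have [M hM] := continuous_bounded_config cF.
apply: lt_le_trans (expR_gt0 (- M)) _; rewrite -(mean_cst mu (expR (- M))).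
apply: mean_le; [exact: cont_cst|exact: cont_expR|move=> x].
by rewrite ler_expR lerNl; apply: le_trans (hM x); rewrite ler_normr lexx orbT.
Qed.

Lemma log_mgf_le mu F G c : continuous F -> continuous G ->
  (forall x, F x <= G x + c) -> log_mgf mu F <= log_mgf mu G + c.
Proof.
move=> cF cG FG; rewrite -[X in _ + X]expRK -lnM ?posrE ?expR_gt0 ?mgf_gt0//.
rewrite ler_ln ?posrE ?mulr_gt0 ?expR_gt0 ?mgf_gt0//.
rewrite mulrC -meanZ; last exact: cont_expR.
apply: mean_le; [exact: cont_expR|by apply: contZ; exact: cont_expR|move=> x].
by rewrite -expRD ler_expR addrC.
Qed.

(** This is Hoelder's inequality, obtained from convexity of the exponential: after subtracting [a]
    and [b], the exponentials of [F] and [G] have mean 1, so their convex combination [K] has mean 1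
    too. *)
Lemma log_mgf_convex mu (t : R) F G : 0 <= t <= 1 -> continuous F -> continuous G ->
  log_mgf mu (fun x => t * F x + (1 - t) * G x) <=
  t * log_mgf mu F + (1 - t) * log_mgf mu G.
Proof.
move=> /andP[t0 t1] cF cG; have t1' : 0 <= 1 - t by rewrite subr_ge0.
have FE : expR (log_mgf mu F) = mean mu (fun x => expR (F x)).
  by rewrite lnK// posrE mgf_gt0.
have GE : expR (log_mgf mu G) = mean mu (fun x => expR (G x)).
  by rewrite lnK// posrE mgf_gt0.
move: FE GE; set a := log_mgf mu F; set b := log_mgf mu G => FE GE.
set H := fun x => _; have cH : continuous (H : Omega -> R).
  by apply: contD; exact: contZ.
rewrite -[leRHS]expRK ler_ln ?posrE ?expR_gt0 ?mgf_gt0//.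
pose K x := t * expR (- a) * expR (F x) + (1 - t) * expR (- b) * expR (G x).
have cK : continuous (K : Omega -> R).
  by apply: contD; apply: contZ; exact: cont_expR.
have KE : mean mu K = 1.
  rewrite /K meanD; [|by apply: contZ; exact: cont_expR..].
  rewrite !meanZ; [|exact: cont_expR..].
  have e u : expR (- u) * expR u = 1 :> R by rewrite -expRD addNr expR0.
  have h (s u v : R) : expR u = v -> s * expR (- u) * v = s.
    by move=> <-; rewrite -mulrA e mulr1.
  by apply: etrans (congr2 +%R (h _ _ _ FE) (h _ _ _ GE)) _; rewrite addrC subrK.
have -> : expR (t * a + (1 - t) * b) =
    mean mu (fun x => expR (t * a + (1 - t) * b) * K x).
  by rewrite meanZ// KE mulr1.
apply: mean_le.
- exact: cont_expR.
- exact: contZ.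
- move=> x.
  have KxE : K x = t * expR (F x - a) + (1 - t) * expR (G x - b).
    have eD (u v : R) : expR (u - v) = expR (- v) * expR u by rewrite expRD mulrC.
    by rewrite /K (eD (F x)) (eD (G x)) !mulrA.
  rewrite KxE (_ : H x = (t * a + (1 - t) * b) + (t * (F x - a) + (1 - t) * (G x - b))).
    by rewrite [leLHS]expRD; apply: ler_wpM2l; rewrite ?expR_ge0// expR_convex// t0.
  by rewrite /H; ring.
Qed.

Lemma log_mgf0 mu : log_mgf mu (fun=> 0) = 0.
Proof. by rewrite /log_mgf expR0 mean_cst ln1. Qed.

Lemma box_sum_lin n a b f g x :
  box_sum n (fun x => a * f x + b * g x) x = a * box_sum n f x + b * box_sum n g x.
Proof. by rewrite /box_sum big_split/= !mulr_sumr. Qed.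

Lemma boxR_gt0 n : 0 < #|` box d n|%:R :> R.
Proof. by rewrite ltr0n card_box_gt0. Qed.

Lemma pressure_seq_le mu n f g c : continuous f -> continuous g ->
  (forall x, f x <= g x + c) -> pressure_seq mu f n <= pressure_seq mu g n + c.
Proof.
move=> cf cg fg; rewrite !pressure_seqE -ler_pdivlMl ?invr_gt0 ?boxR_gt0//.
rewrite invrK mulrDr mulrA divff ?gt_eqF ?boxR_gt0// mul1r.
apply: log_mgf_le; [exact: cont_box_sum..|move=> x].
apply: (@le_trans _ _ (\sum_(i <- box d n) (g (shift i x) + c))).
  by apply: ler_sum => i _.
by rewrite big_split/= lerD2l big_const_seq count_predT iter_addr_0 mulr_natl.
Qed.

Lemma pressure_seq0 mu n : pressure_seq mu (fun=> 0) n = 0.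
Proof.
rewrite pressure_seqE (_ : box_sum n _ = fun=> 0) ?log_mgf0 ?mulr0//.
by apply/funext => x; rewrite /box_sum big1.
Qed.

Lemma pressure_seq_bound mu n f (M : R) : continuous f -> (forall x, `|f x| <= M) ->
  `|pressure_seq mu f n| <= M.
Proof.
move=> cf fM; rewrite ler_norml.
have h x : - M <= f x <= M by rewrite -ler_norml.
have := @pressure_seq_le mu n f (fun=> 0) M cf (cont_cst (a := 0)).
have := @pressure_seq_le mu n (fun=> 0) f M (cont_cst (a := 0)) cf.
rewrite pressure_seq0 add0r => h1 h2; apply/andP; split.
  by rewrite -subr_ge0 opprK; apply: h1 => x; have := h x; lra.
by apply: h2 => x; have := h x; lra.
Qed.

Lemma pressure_seq_cst mu n f c : continuous f ->
  pressure_seq mu (fun x => f x + c) n = pressure_seq mu f n + c.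
Proof.
move=> cf; have cfc : continuous ((fun x => f x + c) : Omega -> R).
  by apply: contD => //; exact: cont_cst.
apply/le_anti/andP; split; first exact: pressure_seq_le.
rewrite -[leRHS](subrK c) lerD2r; apply: pressure_seq_le => // x.
by rewrite addrK.
Qed.

Lemma pressure_seq_convex mu n (t : R) f g : 0 <= t <= 1 ->
  continuous f -> continuous g ->
  pressure_seq mu (fun x => t * f x + (1 - t) * g x) n <=
  t * pressure_seq mu f n + (1 - t) * pressure_seq mu g n.
Proof.
move=> t01 cf cg; rewrite !pressure_seqE mulrCA [X in _ <= _ + X]mulrCA -mulrDr.
rewrite ler_wpM2l ?invr_ge0//.
rewrite (_ : box_sum n _ = fun x => t * box_sum n f x + (1 - t) * box_sum n g x).
  by apply: log_mgf_convex => //; exact: cont_box_sum.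
by apply/funext => x; rewrite box_sum_lin.
Qed.

(** Summed over a box, a coboundary cancels except near the boundary, whose share of the volume
    vanishes in the limit. *)
Lemma pressure_seq_coboundary mu n j f g (M : R) : continuous f -> continuous g ->
  (forall x, `|g x| <= M) ->
  pressure_seq mu (fun x => f x + (g (shift j x) - g x)) n <= pressure_seq mu f n +
    2 * M * (#|` box d (n + rad j)| - #|` box d n|)%:R / #|` box d n|%:R.
Proof.
move=> cf cg gM; rewrite !pressure_seqE [X in _ <= _ + X]mulrC -mulrDr.
rewrite ler_wpM2l ?invr_ge0//; apply: log_mgf_le.
- apply: cont_box_sum; apply: contD => //.
  apply: contD; first exact: cont_shift.
  rewrite (_ : (fun x => - g x) = (fun x => -1 * g x)); first exact: contZ.
  by apply/funext => x; rewrite mulN1r.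
- exact: cont_box_sum.
move=> x; rewrite /box_sum big_split/= lerD2l.
have := @box_shift_sum d R n j (fun i => g (shift i x)) M (fun i => gM _).
apply: le_trans; apply: le_trans (ler_norm _); rewrite -sumrB.
by rewrite le_eqVlt; apply/orP; left; apply/eqP; apply: eq_bigr => i _;
  rewrite shiftD (addrC j).
Qed.

(** The limsup, written as the infimum of the eventual upper bounds; it makes sense before
    convergence is known. *)
Definition upper_pressure mu f : R :=
  inf [set a | \forall n \near \oo, pressure_seq mu f n <= a].

Let upper_pressure_inf mu f : continuous f ->
  has_inf [set a | \forall n \near \oo, pressure_seq mu f n <= a].
Proof.
move=> cf; have [M fM] := continuous_bounded_config cf; split.
  exists M; near=> n; exact: le_trans (ler_norm _) (pressure_seq_bound mu n cf fM).
exists (- M) => a [N _ /(_ N (leqnn N))]; apply: le_trans.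
by have := pressure_seq_bound mu N cf fM; rewrite ler_norml => /andP[].
Unshelve. all: by end_near. Qed.

Lemma upper_pressure_le mu f a : continuous f ->
  (\forall n \near \oo, pressure_seq mu f n <= a) -> upper_pressure mu f <= a.
Proof. by move=> cf fa; apply: ge_inf => //; exact: (upper_pressure_inf mu cf).2. Qed.

Lemma upper_pressure_near mu f a : continuous f -> upper_pressure mu f < a ->
  \forall n \near \oo, pressure_seq mu f n <= a.
Proof.
move=> cf fa; have [b nb ba] := inf_lt (upper_pressure_inf mu cf).1 fa.
by apply: filterS nb => n /le_trans; apply; exact: ltW.
Qed.

Lemma upper_pressure_le_add mu f g c : continuous f -> continuous g ->
  (forall e, 0 < e -> \forall n \near \oo,
    pressure_seq mu f n <= pressure_seq mu g n + c + e) ->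
  upper_pressure mu f <= upper_pressure mu g + c.
Proof.
move=> cf cg fg; apply/ler_addgt0Pr => e e0.
have e20 : 0 < e / 2 by rewrite divr_gt0.
apply: upper_pressure_le => //; near=> n.
have h1 : pressure_seq mu f n <= pressure_seq mu g n + c + e / 2.
  by near: n; exact: fg.
have h2 : pressure_seq mu g n <= upper_pressure mu g + e / 2.
  by near: n; apply: upper_pressure_near => //; rewrite ltrDl.
lra.
Unshelve. all: by end_near. Qed.

Lemma upper_pressure0 mu : upper_pressure mu (fun=> 0) = 0.
Proof.
apply/le_anti/andP; split.
  by apply: upper_pressure_le; [exact: cont_cst|near=> n; rewrite pressure_seq0].
apply/ler_addgt0Pr => e e0.
have : \forall n \near \oo, pressure_seq mu (fun=> 0) n <= upper_pressure mu (fun=> 0) + e.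
  by apply: upper_pressure_near; [exact: cont_cst|rewrite ltrDl].
by move=> [N _ /(_ N (leqnn N))]; rewrite pressure_seq0.
Unshelve. all: by end_near. Qed.

Lemma upper_pressure_convex mu (t : R) f g : 0 <= t <= 1 ->
  continuous f -> continuous g ->
  upper_pressure mu (fun x => t * f x + (1 - t) * g x) <=
  t * upper_pressure mu f + (1 - t) * upper_pressure mu g.
Proof.
move=> t01 cf cg; apply/ler_addgt0Pr => e e0.
apply: upper_pressure_le; first by apply: contD; exact: contZ.
have hf : \forall n \near \oo, pressure_seq mu f n <= upper_pressure mu f + e.
  by apply: upper_pressure_near; rewrite ?ltrDl.
have hg : \forall n \near \oo, pressure_seq mu g n <= upper_pressure mu g + e.
  by apply: upper_pressure_near; rewrite ?ltrDl.
apply: filterS2 hf hg => n h1 h2.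
exact: le_trans (pressure_seq_convex mu n t01 cf cg) (convex_comb_le t01 h1 h2).
Qed.

Lemma upper_pressure_coboundary mu j f g : continuous f -> continuous g ->
  upper_pressure mu (fun x => f x + (g (shift j x) - g x)) <= upper_pressure mu f.
Proof.
move=> cf cg; have [M gM] := continuous_bounded_config cg.
rewrite -[leRHS]addr0; apply: upper_pressure_le_add => //.
- apply: contD => //; apply: contD; first exact: cont_shift.
  rewrite (_ : (fun x => - g x) = (fun x => -1 * g x)); first exact: contZ.
  by apply/funext => x; rewrite mulN1r.
- move=> e e0; have := @box_excess_cvg R d (rad j) (2 * M).
  move=> /cvgrPdist_le/(_ _ e0) h; near=> n.
  apply: le_trans (pressure_seq_coboundary mu n j cf cg gM) _.
  rewrite addr0 lerD2l; apply: le_trans (ler_norm _) _.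
  by rewrite -[leLHS]normrN -[X in `|X|]add0r; near: n.
Unshelve. all: by end_near. Qed.

End pressure.

(** * The Donsker-Varadhan formula for finite marginals *)

Section donsker_varadhan.
Context {R : realType} {I : finType} (m v : I -> R).
Hypotheses (m0 : forall s, 0 <= m s) (v0 : forall s, 0 <= v s).
Hypotheses (m1 : \sum_s m s = 1) (v1 : \sum_s v s = 1).

(** Sum [v ln r <= v (r - 1)] with [r = m e^phi / (v Z)]; the right-hand sides add up to at most 0
    because both [v] and [m e^phi / Z] have total mass 1. *)
Lemma donsker_varadhan_le (phi : I -> R) : (forall s, m s = 0 -> v s = 0) ->
  \sum_s v s * phi s <=
  \sum_s v s * ln (v s / m s) + ln (\sum_s m s * expR (phi s)).
Proof.
move=> mv; set Z := \sum_s m s * expR (phi s).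
have Z0 : 0 < Z.
  rewrite lt_neqAle sumr_ge0 ?andbT//; last by move=> s _; rewrite mulr_ge0// expR_ge0.
  apply/negP; rewrite eq_sym psumr_eq0; last by move=> s _; rewrite mulr_ge0// expR_ge0.
  move=> /allP h; have : \sum_s m s = 0.
    rewrite big1// => s _; have := h s (mem_index_enum s).
    by rewrite implyTb mulf_eq0 [expR _ == 0]gt_eqF ?expR_gt0// orbF => /eqP.
  by rewrite m1 => /eqP; rewrite oner_eq0.
have h s : v s * phi s <=
    v s * ln (v s / m s) + v s * ln Z + (m s * expR (phi s) / Z - v s).
  have [vs0|vs] := eqVneq (v s) 0.
    by rewrite vs0 !mul0r !add0r subr0 divr_ge0 ?(ltW Z0)// mulr_ge0// expR_ge0.
  have vs_gt0 : 0 < v s by rewrite lt_neqAle eq_sym vs v0.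
  have ms : 0 < m s.
    by rewrite lt_neqAle m0 andbT eq_sym; apply/eqP => /mv/eqP; exact/negP.
  set r := m s * expR (phi s) / (v s * Z).
  have r0 : 0 < r by rewrite divr_gt0 ?mulr_gt0 ?expR_gt0.
  have lnr : ln r = phi s - ln (v s / m s) - ln Z.
    rewrite /r !ln_div ?posrE ?mulr_gt0 ?expR_gt0// !lnM ?posrE ?expR_gt0// expRK; lra.
  have : v s * ln r <= v s * (r - 1).
    rewrite ler_wpM2l// -[r in ln r](subrK 1) addrC; apply: le_ln1Dx.
    by rewrite ltrBrDl subrr.
  have -> : v s * (r - 1) = m s * expR (phi s) / Z - v s.
    by rewrite /r; field; rewrite !gt_eqF.
  rewrite lnr !mulrBr.
  lra.
apply: le_trans (ler_sum _ (fun s _ => h s)) _.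
rewrite !big_split/= -!mulr_suml sumrN v1 mul1r -/Z divff ?gt_eqF// subrr addr0.
by [].
Qed.

Lemma donsker_varadhan_ac (K : R) :
  (forall phi : I -> R, \sum_s m s * expR (phi s) <= 1 -> \sum_s v s * phi s <= K) ->
  forall s, m s = 0 -> v s = 0.
Proof.
move=> vK s ms; apply/eqP; rewrite eq_le v0 andbT leNgt; apply/negP => vs.
(* A point charged by [v] but not by [m] carries any value at no exponential cost; this one makes
   the [v]-mean equal to [|K| + 1]. *)
pose phi t := if t == s then (`|K| + 1) / v s else 0.
have := vK phi; rewrite (bigD1 s)//= ms mul0r add0r.
rewrite (eq_bigr m); last first.
  by move=> t /negbTE ts; rewrite /phi ts expR0 mulr1.
have -> : \sum_(t | t != s) m t = 1 by rewrite -m1 [RHS](bigD1 s)//= ms add0r.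
rewrite (bigD1 s)//= big1 ?addr0; last first.
  by move=> t /negbTE ts; rewrite /phi ts mulr0.
rewrite /phi eqxx mulrC divfK ?gt_eqF// => /(_ (lexx _)); apply/negP.
by rewrite -ltNge; apply: le_lt_trans (ler_norm _) _; rewrite ltrDl.
Qed.

(* The optimal test function [ln (v / m)] may be infinite, so it is replaced by
   [ln ((1 - e) v / m + e)]. *)
Lemma donsker_varadhan_ge (K : R) : (forall s, m s = 0 -> v s = 0) ->
  (forall phi : I -> R, \sum_s m s * expR (phi s) <= 1 -> \sum_s v s * phi s <= K) ->
  \sum_s v s * ln (v s / m s) <= K.
Proof.
move=> mv vK.
have main (e : R) : 0 < e -> e < 1 -> \sum_s v s * ln (v s / m s) + ln (1 - e) <= K.
  move=> e0 e1; have e1' : 0 < 1 - e by rewrite subr_gt0.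
  pose q s := (1 - e) * (v s / m s) + e.
  have q0 s : 0 < q s.
    by rewrite ltr_wpDl// mulr_ge0 ?(ltW e1')// divr_ge0.
  have /vK : \sum_s m s * expR (ln (q s)) <= 1.
    have -> : 1 = (1 - e) * \sum_s v s + e * \sum_s m s by rewrite v1 m1; lra.
    rewrite !mulr_sumr -big_split/=; apply: ler_sum => s _.
    rewrite lnK ?posrE// /q; have [ms|ms] := eqVneq (m s) 0.
      by rewrite ms mul0r mv// !mulr0 addr0.
    by rewrite le_eqVlt; apply/orP; left; apply/eqP; field.
  apply: le_trans.
  have -> : ln (1 - e) = \sum_s v s * ln (1 - e) by rewrite -mulr_suml v1 mul1r.
  rewrite -big_split/=; apply: ler_sum => s _.
  have [vs0|vs] := eqVneq (v s) 0; first by rewrite vs0 !mul0r addr0.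
  rewrite -mulrDr ler_wpM2l//.
  have vs_gt0 : 0 < v s by rewrite lt_neqAle eq_sym vs v0.
  have ms : 0 < m s.
    by rewrite lt_neqAle m0 andbT eq_sym; apply/eqP => /mv/eqP; exact/negP.
  rewrite -lnM ?posrE ?divr_gt0// ler_ln ?posrE ?q0 ?mulr_gt0 ?invr_gt0//.
  by rewrite /q mulrC lerDl ltW.
rewrite leNgt; apply/negP; set L := \sum_s _ => KL.
(* With this [e], [ln (1 - e)] gives back only half of the supposed gap [L - K]. *)
have := main (1 - expR (- ((L - K) / 2))).
rewrite subKr expRK subr_gt0 expR_lt1 ltrBlDl ltrDr expR_gt0 oppr_lt0.
rewrite divr_gt0 ?subr_gt0//.
move=> /(_ isT isT); rewrite -/L; lra.
Qed.

End donsker_varadhan.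

(** * Relative entropy on finite sets as a supremum over local functions *)

Section relative_entropy.
Context {R : realType} {S : pointedFinType} {d : nat}.
Local Notation Omega := (config S d).
Implicit Types (mu nu : probability Omega R) (L : {fset 'rV[int]_d}).

Lemma marginal_pmf_ge0 L mu s : 0 <= @marginal_pmf R S d L mu s.
Proof. exact/fine_ge0/measure_ge0. Qed.

Lemma mean_marginal L mu (f : Omega -> R) : depends_on [set` L] f ->
  mean mu f = \sum_(s : {ffun L -> S}) f (ext_config s) * marginal_pmf mu s.
Proof.
move=> fL; rewrite {1}(funext (depends_on_decomp fL)).
by rewrite mean_cylinders// => s; exact: local_cylinder.
Qed.

Lemma sum_marginal_pmf L mu : \sum_s @marginal_pmf R S d L mu s = 1.
Proof.
rewrite -(mean_cst mu 1) (@mean_marginal L) => [|//].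
by apply: eq_bigr => s _; rewrite mul1r.
Qed.

Lemma marginal_pmf_ac L mu nu :
  (forall B : set {ffun L -> S}, marginal mu B = 0%E -> marginal nu B = 0%E) <->
  (forall s, @marginal_pmf R S d L mu s = 0 -> @marginal_pmf R S d L nu s = 0).
Proof.
have fin (P : probability Omega R) (B : set {ffun L -> S}) : marginal P B \is a fin_num.
  apply: fin_num_measure; apply: local_measurable; apply: local_fset.
  move=> x y xy; rewrite /preimage/=; congr (B _).
  by apply/ffunP => i; rewrite !ffunE; apply: xy; exact: valP.
split=> [ac s|ac B mB].
  rewrite /marginal_pmf => h; rewrite ac//.
  by rewrite -[LHS]fineK ?h// fin.
have lB : local (restr L @^-1` B : set Omega).
  apply: local_fset; move=> x y xy; rewrite /preimage/=; congr (B _).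
  by apply/ffunP => i; rewrite !ffunE; apply: xy; exact: valP.
have dB : depends_on [set` L] (\1_(restr L @^-1` B) : Omega -> R).
  move=> x y xy; rewrite !indicE; congr (_%:R); congr nat_of_bool.
  have -> // : (x \in restr L @^-1` B) = (y \in restr L @^-1` B).
  have e : restr L x = restr L y.
    by apply/ffunP => i; rewrite !ffunE; apply: xy; exact: valP.
  by apply/idP/idP => /set_mem h; apply/mem_set; move: h; rewrite /preimage/= e.
have E (P : probability Omega R) : fine (marginal P B) =
    \sum_(s : {ffun L -> S}) \1_(restr L @^-1` B) (ext_config s) * marginal_pmf P s.
  by rewrite -(mean_marginal P dB) mean_indic//; exact: local_measurable.
rewrite -[LHS]fineK ?fin// E big1// => s _.
have := E mu; rewrite mB/= => /esym/eqP; rewrite psumr_eq0; last first.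
  by move=> t _; rewrite mulr_ge0 ?marginal_pmf_ge0// indicE.
move=> /allP/(_ s (mem_index_enum s))/=; rewrite mulf_eq0 => /orP[/eqP ->|/eqP].
  by rewrite mul0r.
by move=> /ac ->; rewrite mulr0.
Qed.

Lemma rel_entropy_lb L nu mu (f : Omega -> R) : depends_on [set` L] f ->
  ((mean nu f - ln (mean mu (fun x => expR (f x))))%:E <= rel_entropy L nu mu)%E.
Proof.
move=> fL; rewrite /rel_entropy; case: asboolP => [|_]; last by rewrite leey.
move=> /marginal_pmf_ac ac; rewrite lee_fin.
have eL : depends_on [set` L] (fun x => expR (f x)) by move=> x y /fL ->.
rewrite (mean_marginal nu fL) (mean_marginal mu eL) lerBlDr.
have := donsker_varadhan_le (@marginal_pmf_ge0 L mu)
  (@marginal_pmf_ge0 L nu) (sum_marginal_pmf L mu) (sum_marginal_pmf L nu)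
  (fun s => f (ext_config s)) ac.
under eq_bigr do rewrite mulrC.
by under [in X in _ <= _ + ln X]eq_bigr do rewrite mulrC.
Qed.

Lemma rel_entropy_ub L nu mu (K : R) :
  (forall f : Omega -> R, depends_on [set` L] f ->
    mean mu (fun x => expR (f x)) <= 1 -> mean nu f <= K) ->
  (rel_entropy L nu mu <= K%:E)%E.
Proof.
move=> fK.
have phiK (phi : {ffun L -> S} -> R) :
    \sum_s marginal_pmf mu s * expR (phi s) <= 1 ->
    \sum_s marginal_pmf nu s * phi s <= K.
  move=> h; pose f (x : Omega) := phi (restr L x).
  have ext (s : {ffun L -> S}) : restr L (ext_config s) = s.
    by apply/ffunP => i; rewrite ffunE /ext_config valK.
  have fL : depends_on [set` L] f.
    move=> x y xy; rewrite /f; congr (phi _).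
    by apply/ffunP => i; rewrite !ffunE; apply: xy; exact: valP.
  have eL : depends_on [set` L] (fun x => expR (f x)) by move=> x y /fL ->.
  have := fK f fL; rewrite (mean_marginal nu fL) (mean_marginal mu eL).
  have <- : \sum_(s : {ffun L -> S}) f (ext_config s) * marginal_pmf nu s =
      \sum_s marginal_pmf nu s * phi s.
    by apply: eq_bigr => s _; rewrite mulrC /f ext.
  apply; apply: le_trans h; rewrite le_eqVlt; apply/orP; left; apply/eqP.
  by apply: eq_bigr => s _; rewrite mulrC /f ext.
have ac := donsker_varadhan_ac (@marginal_pmf_ge0 L nu)
  (sum_marginal_pmf L mu) phiK.
rewrite /rel_entropy asboolT; last exact/marginal_pmf_ac.
rewrite lee_fin; apply: donsker_varadhan_ge ac phiK => //;
  [exact: marginal_pmf_ge0|exact: marginal_pmf_ge0|exact: sum_marginal_pmf..].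
Qed.

End relative_entropy.

(** * Asymptotic decoupling *)

(** Jensen's inequality for a uniform average, from the tangent to the exponential at the mean
    [m]. *)
Lemma expR_mean_le (R : realType) (I : finType) (b : I -> R) : (0 < #|I|)%N ->
  expR ((\sum_k b k) / #|I|%:R) <= (\sum_k expR (b k)) / #|I|%:R.
Proof.
move=> I0; have I0' : 0 < #|I|%:R :> R by rewrite ltr0n.
set m := _ / _; rewrite ler_pdivlMr//.
have h k : expR m * (1 + (b k - m)) <= expR (b k).
  rewrite -[in leRHS](subrK m (b k)) [in leRHS]addrC expRD.
  by rewrite ler_wpM2l ?expR_ge0// expR_ge1Dx.
apply: le_trans (ler_sum _ (fun k _ => h k)).
rewrite -mulr_sumr ler_wpM2l ?expR_ge0// !big_split/= sumrN !sumr_const.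
have -> : \sum_i b i = m *+ #|I| by rewrite -mulr_natr /m divfK ?gt_eqF.
by rewrite subrr addr0.
Qed.

Section decoupling.
Context {R : realType} {S : pointedFinType} {d : nat}.
Local Notation Omega := (config S d).
Local Notation Zd := 'rV[int]_d.
Implicit Types (mu : probability Omega R) (f F G : Omega -> R).

(** Gluing [x] on a box to [y] outside it shows that only the sites of [K] in the box matter. It
    makes a local function on an infinite set such as the complement of a box expandable in finite
    cylinders. *)
Lemma depends_on_fset (K : set Zd) (f : Omega -> R) : depends_on K f -> local f ->
  exists L : {fset Zd}, [set` L] `<=` K /\ depends_on [set` L] f.
Proof.
move=> fK [m fm].
have fin : finite_set (K `&` box_set m).
  by apply: sub_finite_set (finite_box_set d m) => i [].
exists (fset_set (K `&` box_set m)); rewrite fset_setK//; split; first by move=> i [].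
move=> x y xy; pose z : Omega := fun i => if `[< box_set m i >] then x i else y i.
rewrite (fm x z); last by move=> i mi; rewrite /z asboolT.
by apply: fK => i Ki; rewrite /z; case: asboolP => // mi; exact: xy.
Qed.

Lemma coord_sigma_cylinder (K : set Zd) (L : {fset Zd}) (s : {ffun L -> S}) :
  [set` L] `<=` K -> coord_sigma K (restr L @^-1` [set s] : set Omega).
Proof.
move=> LK; pose G := \bigcup_(i in K) preimage_set_system [set: Omega]
  (fun eta : Omega => eta i) [set: set S].
have -> : restr L @^-1` [set s] =
    \bigcap_(i in [set: L]) ((fun eta : Omega => eta (val i)) @^-1` [set s i]).
  apply/seteqP; split => [x <- i _|x h]; first by rewrite /= ffunE.
  by apply/ffunP => i; rewrite ffunE; exact: h.
have h : forall i : L, [set: L] i ->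
    @measurable _ (g_sigma_algebraType G)
      ((fun eta : Omega => eta (val i)) @^-1` [set s i]).
  move=> i _; apply: sub_sigma_algebra; exists (val i); first by apply: LK; exact: valP.
  by exists [set s i] => //; rewrite setTI.
have := @fin_bigcap_measurable _ (g_sigma_algebraType G) L [set: L]
  (fun i => (fun eta : Omega => eta (val i)) @^-1` [set s i]) finite_finset h.
exact.
Qed.

(** Expanding both factors in cylinders reduces to the bound for events; nonnegative coefficients
    preserve the inequality. *)
Lemma mean_mul_decoupled mu c (K1 K2 : set Zd) F G :
  (forall A B, coord_sigma K1 A -> coord_sigma K2 B ->
    (mu (A `&` B) <= (expR c)%:E * (mu A * mu B))%E) ->
  depends_on K1 F -> local F -> depends_on K2 G -> local G ->
  (forall x, 0 <= F x) -> (forall x, 0 <= G x) ->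
  mean mu (fun x => F x * G x) <= expR c * (mean mu F * mean mu G).
Proof.
move=> dec F1 lF G2 lG F0 G0.
have [L1 [LK1 FL1]] := depends_on_fset F1 lF.
have [L2 [LK2 GL2]] := depends_on_fset G2 lG.
pose A (s : {ffun L1 -> S}) := restr L1 @^-1` [set s] : set Omega.
pose B (s : {ffun L2 -> S}) := restr L2 @^-1` [set s] : set Omega.
have lA s : local (A s) by exact: local_cylinder.
have lB s : local (B s) by exact: local_cylinder.
have -> : (fun x => F x * G x) = (fun x => \sum_(st <- index_enum _)
    (F (ext_config (L := L1) st.1) * G (ext_config (L := L2) st.2)) *
    \1_(A st.1 `&` B st.2) x).
  apply/funext => x; rewrite (depends_on_decomp FL1 x) (depends_on_decomp GL2 x).
  rewrite big_distrlr/= pair_bigA/=; apply: eq_bigr => st _.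
  by rewrite indicI/=; ring.
rewrite mean_cylinders; last by move=> st; exact: local_setI.
rewrite [in mean mu F](funext (depends_on_decomp FL1)).
rewrite [in mean mu G](funext (depends_on_decomp GL2)).
rewrite !mean_cylinders//.
rewrite big_distrlr/= pair_bigA/= mulr_sumr; apply: ler_sum => -[s t] _ /=.
have mA := local_measurable (lA s); have mB := local_measurable (lB t).
have : fine (mu (A s `&` B t)) <= expR c * (fine (mu (A s)) * fine (mu (B t))).
  have := dec _ _ (coord_sigma_cylinder s LK1) (coord_sigma_cylinder t LK2).
  rewrite -/(A s) -/(B t) -lee_fin !EFinM !fineK//.
  - exact: fin_num_measure.
  - exact: fin_num_measure.
  - by apply: fin_num_measure; exact: measurableI.
move=> /(ler_wpM2l (mulr_ge0 (F0 (ext_config s)) (G0 (ext_config t)))).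
move=> /le_trans; apply; rewrite le_eqVlt; apply/orP; left; apply/eqP.
rewrite -/(A s) -/(B t); ring.
Qed.

Variables (mu : probability Omega R) (n g : nat) (c : R).
Hypothesis mu_inv : translation_invariant mu.
Hypothesis dec : forall (j : Zd) A B,
  coord_sigma (translate [set` box d n] j) A ->
  coord_sigma (~` translate [set` box d (n + g)] j) B ->
  (mu (A `&` B) <= (expR c)%:E * (mu A * mu B))%E.

Lemma mean_prod_decoupled (psi : Omega -> R) (s : seq Zd) :
  depends_on (box_set n) psi -> (forall x, 0 <= psi x) -> uniq s ->
  {in s &, forall i j, i != j -> ~ box_set (n + (n + g)) (i - j)} ->
  mean mu (fun x => \prod_(i <- s) psi (shift i x)) <=
  (expR c * mean mu psi) ^+ size s.
Proof.
move=> psin psi0; have lpsi : local psi by exists n.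
have lprod t : local (fun x => \prod_(i <- t) psi (shift i x)).
  elim: t => [|i t ih].
    by under eq_fun do rewrite big_nil; exact: local_cst.
  under eq_fun do rewrite big_cons.
  by apply: (local2 (fun u v : R => u * v)) => //; exact: local_shift.
elim: s => [|i s ih] /=.
  by move=> _ _; under eq_fun do rewrite big_nil; rewrite mean_cst expr0.
move=> /andP[iNs us] sep.
have -> : (fun x => \prod_(j <- i :: s) psi (shift j x)) =
    (fun x => psi (shift i x) * \prod_(j <- s) psi (shift j x)).
  by apply/funext => x; rewrite big_cons.
(* [shift i x] reads [x] at [k - i], so the observable lives on the box around [- i]. *)
have F1 : depends_on (translate [set` box d n] (- i)) (fun x => psi (shift i x)).
  move=> x y xy; apply: psin => k nk; apply: xy; exists k => //; exact/in_box.
have G1 : depends_on (~` translate [set` box d (n + g)] (- i))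
    (fun x => \prod_(j <- s) psi (shift j x)).
  move=> x y xy; apply: eq_big_seq => j js; apply: psin => k nk; apply: xy.
  move=> [l /in_box nl lk]; apply: (sep i j); rewrite ?mem_head ?inE ?js ?orbT//.
    by apply: contraNneq iNs => ->.
  (* A site shared by the box of radius [n + g] around [- i] and the box of radius [n] around [- j]
     would put [i - j] in the box of radius [2n + g], against the separation. *)
  have -> : i - j = l - k.
    rewrite -[l](subrK i) lk [X in _ = X - _]addrC -[RHS]addrA.
    by rewrite [k - j - k]addrAC subrr add0r.
  by rewrite addnC; apply: box_setD nl (box_setN nk).
have G0 x : 0 <= \prod_(j <- s) psi (shift j x) by apply: prodr_ge0.
have H := mean_mul_decoupled (@dec (- i)) F1 (local_shift i lpsi) G1
  (lprod s) (fun x => psi0 (shift i x)) G0.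
apply: le_trans H _.
rewrite exprS -mulrA ler_wpM2l ?expR_ge0//.
rewrite mean_shift//; last exact: local_continuous.
have h0 : 0 <= mean mu psi.
  rewrite -(mean_cst mu 0); apply: mean_le => //; [exact: cont_cst|exact: local_continuous].
apply: ler_wpM2l => //; apply: ih => // i' j' i's j's.
by apply: sep; rewrite inE ?i's ?j's orbT.
Qed.

(** The box sum is the average over the [M] residue classes of [M] times the class sums, so Jensen's
    inequality reduces to one class. Its sites are separated, and each of them contributes at most a
    factor [e^c]. *)
Lemma mean_expR_box_sum_le (h : Omega -> R) N : 0 <= c ->
  depends_on (box_set n) h ->
  mean mu (fun x => expR (((n + (n + g)).+1 ^ d)%:R * h x)) <= 1 ->
  mean mu (fun x => expR (box_sum N h x)) <=
  expR (c * ((N.*2 %/ (n + (n + g)).+1).+1 ^ d)%:R).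
Proof.
set l := (n + (n + g))%N => c0 hn; set M := (l.+1 ^ d)%:R => hM.
have lh : local h by exists n.
have ch : continuous h by exact: local_continuous.
pose cls := {ffun 'I_d -> 'I_l.+1}.
have cardE : #|{: cls}| = (l.+1 ^ d)%N by rewrite card_ffun !card_ord.
pose s (k : cls) := [seq i <- box d N | box_class N l i == k].
pose a (k : cls) x := \sum_(i <- s k) h (shift i x).
pose psi x := expR (M * h x).
have aE k x : expR (M * a k x) = \prod_(i <- s k) psi (shift i x).
  by rewrite mulr_sumr expR_sum.
have bE x : box_sum N h x = (\sum_k M * a k x) / #|{: cls}|%:R.
  rewrite cardE -/M -mulr_sumr mulrC mulKf; last first.
    by rewrite /M pnatr_eq0 expn_eq0.
  rewrite /box_sum (partition_big (box_class N l) predT)//=.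
  by apply: eq_bigr => k _; rewrite /a /s big_filter.
have ca k : continuous (a k : Omega -> R).
  by apply: cont_sum => i; exact: cont_shift.
have cMa k : continuous ((fun x => expR (M * a k x)) : Omega -> R).
  by apply: cont_expR; exact: contZ.
have step k : mean mu (fun x => expR (M * a k x)) <=
    expR (c * ((N.*2 %/ l.+1).+1 ^ d)%:R).
  rewrite (funext (aE k)).
  apply: le_trans (mean_prod_decoupled _ _ _ _) _.
  - by move=> x y /hn; rewrite /psi => ->.
  - by move=> x; exact: expR_ge0.
  - by rewrite filter_uniq// fset_uniq.
  - move=> i j; rewrite !mem_filter => /andP[/eqP ik iN] /andP[/eqP jk jN] ij.
    have [|e] := box_class_sep iN jN (etrans ik (esym jk)); first by [].
    by rewrite e eqxx in ij.
  apply: (@le_trans _ _ (expR c ^+ size (s k))).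
    apply: lerXn2r; rewrite ?nnegrE ?expR_ge0//.
      rewrite mulr_ge0 ?expR_ge0// -(mean_cst mu 0); apply: mean_le.
      - exact: cont_cst.
      - by apply: cont_expR; exact: contZ.
      - by move=> x; exact: expR_ge0.
    by rewrite ler_piMr ?expR_ge0.
  by rewrite -expRM_natl ler_expR mulrC ler_wpM2l// ler_nat size_box_class.
have I0 : (0 < #|{: cls}|)%N by rewrite cardE expn_gt0.
apply: (@le_trans _ _ (mean mu (fun x =>
    \sum_(k <- index_enum cls) (#|{: cls}|%:R)^-1 * expR (M * a k x)))).
  apply: mean_le.
  - by apply: cont_expR; exact: cont_box_sum.
  - by apply: cont_sum => k; exact: contZ.
  - move=> x; have e1 := expR_mean_le (fun k : cls => M * a k x) I0.
    have e2 := congr1 expR (bE x).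
    apply: le_trans (_ : expR (box_sum N h x) <= _) _; first by rewrite e2; exact: e1.
    by rewrite mulr_suml; apply: ler_sum => k _; rewrite mulrC.
have sumE (r : seq cls) : mean mu (fun x =>
    \sum_(k <- r) (#|{: cls}|%:R)^-1 * expR (M * a k x)) <=
    \sum_(k <- r) (#|{: cls}|%:R)^-1 * expR (c * ((N.*2 %/ l.+1).+1 ^ d)%:R).
  elim: r => [|k r ih].
    by under eq_fun do rewrite big_nil; rewrite mean_cst big_nil.
  under eq_fun do rewrite big_cons.
  rewrite meanD; [|exact: contZ|by apply: cont_sum => k'; exact: contZ].
  rewrite big_cons; apply: lerD => //.
  by rewrite meanZ// ler_wpM2l// invr_ge0.
apply: le_trans (sumE _) _.
have sumC (z : R) : \sum_(k : cls) z = #|{: cls}|%:R * z.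
  by rewrite sumr_const mulr_natl.
by rewrite sumC mulrA divff ?mul1r// pnatr_eq0 -lt0n.
Qed.

Lemma upper_pressure_decoupled (h : Omega -> R) : 0 <= c ->
  depends_on (box_set n) h ->
  mean mu (fun x => expR (((n + (n + g)).+1 ^ d)%:R * h x)) <= 1 ->
  upper_pressure mu h <= c / ((n + (n + g)).+1 ^ d)%:R.
Proof.
move=> c0 hn; set q := (n + (n + g)).+1; set M := (q ^ d)%:R => hM.
have ch : continuous h by apply: local_continuous; exists n.
have M0 : 0 < M by rewrite ltr0n expn_gt0.
have cv := cvg_pow_onePD d (cvg_cst_odd (q%:R : R)).
apply/ler_addgt0Pr => e e0; apply: upper_pressure_le => //.
(* The error will be multiplied by [c / M]; the added 1 keeps the denominator positive when
   [c = 0]. *)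
have e'0 : 0 < e / (c / M + 1) by rewrite divr_gt0// ltr_wpDl// divr_ge0// ltW.
move/cvgrPdist_le : cv => /(_ _ e'0) cv; near=> N.
have : `|1 - (1 + q%:R / N.*2.+1%:R) ^+ d| <= e / (c / M + 1) by near: N.
rewrite distrC => /(le_trans (ler_norm _)); rewrite lerBlDr => hN.
rewrite pressure_seqE -ler_pdivlMl ?invr_gt0 ?boxR_gt0// invrK.
rewrite /log_mgf -[leRHS]expRK ler_ln ?posrE ?expR_gt0 ?mgf_gt0//; last first.
  exact: cont_box_sum.
apply: le_trans (mean_expR_box_sum_le N c0 hn hM) _; rewrite ler_expR.
rewrite card_box natrX -/q.
have q0 : 0 < q%:R :> R by rewrite ltr0n.
have N0 : 0 < N.*2.+1%:R :> R by rewrite ltr0n.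
(* The class size per direction is at most [(2N + 1 + q) / q], so after division by the volume of
   the box the bound tends to [c / q^d = c / M]. *)
have hq : (N.*2 %/ q).+1%:R <= N.*2.+1%:R * (1 + q%:R / N.*2.+1%:R) / q%:R :> R.
  rewrite ler_pdivlMr// mulrDr mulr1 mulrCA divff ?gt_eqF// mulr1 -natrM -natrD ler_nat.
  by have := leq_trunc_div N.*2 q; rewrite mulSn; lia.
apply: (@le_trans _ _ (c * (N.*2.+1%:R * (1 + q%:R / N.*2.+1%:R) / q%:R) ^+ d)).
  apply: ler_wpM2l => //; apply: lerXn2r; rewrite ?nnegrE//.
rewrite !exprMn exprVn -!natrX -/M.
rewrite (_ : c * _ = (N.*2.+1 ^ d)%:R * ((1 + q%:R / N.*2.+1%:R) ^+ d * (c / M))).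
  2: by ring.
apply: ler_wpM2l; first exact: ler0n.
have cM : 0 <= c / M by rewrite divr_ge0// ltW.
apply: (@le_trans _ _ ((e / (c / M + 1) + 1) * (c / M))); first by rewrite ler_wpM2r.
rewrite mulrDl mul1r addrC lerD2l -mulrA ler_piMr ?(ltW e0)//.
by rewrite mulrC ler_pdivrMr ?mul1r ?lerDl// ltr_wpDl.
Unshelve. all: by end_near. Qed.

End decoupling.

(** * The variational principle *)

Section variational_principle.
Context {R : realType} {S : pointedFinType} {d : nat}.
Local Notation Omega := (config S d).
Local Notation Zd := 'rV[int]_d.
Variables (mu : probability Omega R) (g : nat -> nat) (c : nat -> R).
Hypothesis mu_inv : translation_invariant mu.
Hypothesis c0 : forall n, 0 <= c n.
Hypothesis g_cvg : ((g n)%:R / n%:R : R) @[n --> \oo] --> (0 : R).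
Hypothesis c_cvg : (c n / #|` box d n|%:R) @[n --> \oo] --> (0 : R).
Hypothesis dec : forall n (j : Zd) A B,
  coord_sigma (translate [set` box d n] j) A ->
  coord_sigma (~` translate [set` box d (n + g n)] j) B ->
  (mu (A `&` B) <= (expR (c n))%:E * (mu A * mu B))%E.

Let M n : R := ((n + (n + g n)).+1 ^ d)%:R.

Lemma mean_box_sum (nu : probability Omega R) n f : translation_invariant nu ->
  continuous f -> mean nu (box_sum n f) = #|` box d n|%:R * mean nu f.
Proof.
move=> nu_inv cf; rewrite /box_sum.
have H (r : seq Zd) : mean nu (fun x => \sum_(i <- r) f (shift i x)) =
    (size r)%:R * mean nu f.
  elim: r => [|i r ih].
    by under eq_fun do rewrite big_nil; rewrite mean_cst mul0r.
  under eq_fun do rewrite big_cons.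
  rewrite meanD; [|exact: cont_shift|by apply: cont_sum => j; exact: cont_shift].
  by rewrite ih mean_shift//= -natr1 mulrDl mul1r addrC.
exact: H.
Qed.

(** The test function is the sum of the translates of [f] over the box of radius [N]; it looks at
    the box of radius [N + n]. *)
Lemma rel_entropy_box_lb (nu : probability Omega R) f n N :
  translation_invariant nu -> depends_on (box_set n) f ->
  ((#|` box d N|%:R * (mean nu f - pressure_seq mu f N))%:E <=
    rel_entropy (box d (N + n)) nu mu)%E.
Proof.
move=> nu_inv fn; have cf : continuous f by apply: local_continuous; exists n.
have fL : depends_on [set` box d (N + n)] (box_sum N f).
  move=> x y xy; apply: eq_big_seq => i /in_box iN; apply: fn => k kn.
  apply: xy; apply/in_box; rewrite addnC; exact: box_setD kn (box_setN iN).
have e : #|` box d N|%:R * pressure_seq mu f N = log_mgf mu (box_sum N f).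
  by rewrite pressure_seqE mulVKf// gt_eqF// boxR_gt0.
by rewrite mulrBr e; have := rel_entropy_lb nu mu fL; rewrite mean_box_sum.
Qed.

Lemma rel_entropy_box_ub (nu : probability Omega R) (K : R) n :
  (forall h, local h -> mean nu h - upper_pressure mu h <= K) ->
  (rel_entropy (box d n) nu mu <= (M n * K + c n)%:E)%E.
Proof.
move=> hK; apply: rel_entropy_ub => f fL f1.
have M0 : 0 < M n by rewrite ltr0n expn_gt0.
have fn : depends_on (box_set n) f by apply: depends_onS fL => i /in_box.
have cf : continuous f by apply: local_continuous; exists n.
pose h x := (M n)^-1 * f x.
have hn : depends_on (box_set n) h by move=> x y /fn; rewrite /h => ->.
have := @upper_pressure_decoupled R S d mu n (g n) (c n) mu_inv (@dec n) h (c0 n) hn.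
rewrite -/(M n) => /(_ _)/wrap[].
  rewrite (_ : (fun x => _) = (fun x => expR (f x)))//; apply/funext => x.
  by rewrite /h mulVKf// gt_eqF.
move=> hp; have lh : local h by exists n.
have := hK h lh; rewrite /h meanZ// -/h => hK'.
have {}hK' : (M n)^-1 * mean nu f <= K + c n / M n.
  by rewrite -lerBlDr; apply: le_trans hK'; rewrite lerD2l lerN2.
move: hK'; rewrite ler_pdivrMl// mulrDr mulrCA divff ?mulr1// gt_eqF//.
Qed.

(** [M N / |Lambda_N|] equals [(1 + g(N) / (2N + 1))^d] and tends to 1. The offset [n] allows the
    entropy of the box of radius [N + n] to be normalized by the volume of the smaller box. *)
Lemma entropy_ub_cvg (K : R) (n : nat) :
  (M (N + n) * K + c (N + n)%N) / #|` box d N|%:R @[N --> \oo] --> K.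
Proof.
have Mcvg : M N / #|` box d N|%:R @[N --> \oo] --> (1 : R).
  have gc : (g N)%:R / N.*2.+1%:R @[N --> \oo] --> (0 : R).
    apply: (@squeeze_cvgr _ _ _ _ (fun=> 0) (fun N => (g N)%:R / N%:R)) => //;
      last exact: cvg_cst.
    near=> N; rewrite divr_ge0//= ler_wpM2l// lef_pV2 ?posrE ?ltr0n//.
      by rewrite ler_nat -addnn; lia.
    by near: N; exact: nbhs_infty_gt.
  apply: cvg_trans (cvg_pow_onePD d gc); apply: near_eq_cvg; near=> N.
  rewrite /M card_box !natrX -exprVn -exprMn; congr (_ ^+ d).
  by rewrite addnA -addSn addnn natrD mulrDl divff ?pnatr_eq0.
have rcvg := @box_ratio_cvg R d n.
have sM : M (N + n) / #|` box d (N + n)|%:R @[N --> \oo] --> (1 : R).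
  by move: Mcvg; rewrite -(cvg_shiftn n).
have sc : c (N + n)%N / #|` box d (N + n)|%:R @[N --> \oo] --> (0 : R).
  by move: c_cvg; rewrite -(cvg_shiftn n).
have h : (M (N + n) / #|` box d (N + n)|%:R * K + c (N + n)%N / #|` box d (N + n)|%:R)
    * (#|` box d (N + n)|%:R / #|` box d N|%:R) @[N --> \oo] --> (1 * K + 0) * 1.
  apply: cvgM => //; apply: cvgD => //; apply: cvgM => //; exact: cvg_cst.
rewrite mul1r addr0 mulr1 in h; apply: cvg_trans h; apply: near_eq_cvg; near=> N.
by field; rewrite !gt_eqF// ?boxR_gt0.
Unshelve. all: by end_near. Qed.

Let s (nu : probability Omega R) n :=
  (rel_entropy (box d n) nu mu * ((#|` box d n|%:R)^-1)%:E)%E.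

Let midpoint_lt (a x p : R) : a < x - p ->
  a < (a + (x - p)) / 2 /\ p < x - (a + (x - p)) / 2.
Proof. by move=> ?; split; lra. Qed.

Lemma entropy_seq_lb (nu : probability Omega R) h a :
  translation_invariant nu -> local h -> a < mean nu h - upper_pressure mu h ->
  \forall n \near \oo, (a%:E <= s nu n)%E.
Proof.
(* The midpoint [v] leaves room on one side for the ratio of the box volumes and on the other for
   the approach to the limsup. *)
move=> nu_inv [m hm] /midpoint_lt[]; set v := (a + _) / 2 => av pv.
have ch : continuous h by apply: local_continuous; exists m.
have r1 : #|` box d N|%:R / #|` box d (N + m)|%:R @[N --> \oo] --> (1 : R).
  have := cvgV (oner_neq0 R) (@box_ratio_cvg R d m); rewrite invr1 => h1.
  rewrite (_ : (fun N => _) =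
      (fun N => (#|` box d (N + m)|%:R / #|` box d N|%:R)^-1)); first exact: h1.
  by apply/funext => N; rewrite invf_div.
have rv : #|` box d N|%:R / #|` box d (N + m)|%:R * v @[N --> \oo] --> v.
  rewrite -[X in _ --> X]mul1r; apply: cvgM => //; exact: cvg_cst.
have [N1 _ hN1] : \forall N \near \oo,
    a <= #|` box d N|%:R / #|` box d (N + m)|%:R * v.
  by apply: (cvgr_ge v).
have [N2 _ hN2] := upper_pressure_near ch pv.
exists (maxn N1 N2 + m)%N => // n /= nN.
have [N nE] : exists N, n = (N + m)%N.
  by exists (n - m)%N; rewrite subnK//; apply: leq_trans nN; exact: leq_addl.
move: nN; rewrite nE leq_add2r geq_max => /andP[N1N N2N].
apply: (@le_trans _ _ ((#|` box d N|%:R * (mean nu h - pressure_seq mu h N))%:E *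
    ((#|` box d (N + m)|%:R)^-1)%:E)%E); last first.
  by apply: lee_wpmul2r; [rewrite lee_fin invr_ge0|exact: rel_entropy_box_lb].
rewrite -EFinM lee_fin; apply: le_trans (hN1 N N1N) _.
rewrite mulrAC ler_wpM2r ?invr_ge0// ler_wpM2l//.
by have := hN2 N N2N; rewrite lerBrDr => h1; rewrite lerBrDr addrC.
Unshelve. all: by end_near. Qed.

Lemma entropy_seq_ub (nu : probability Omega R) (K a : R) :
  (forall h, local h -> mean nu h - upper_pressure mu h <= K) -> K < a ->
  \forall n \near \oo, (s nu n <= a%:E)%E.
Proof.
move=> hK Ka; have := @entropy_ub_cvg K 0%N.
move=> /(cvgr_le K)/(_ _ Ka); apply: filterS => n; rewrite addn0 => h.
apply: (@le_trans _ _ ((M n * K + c n)%:E * ((#|` box d n|%:R)^-1)%:E)%E).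
  by apply: lee_wpmul2r; [rewrite lee_fin invr_ge0|exact: rel_entropy_box_ub].
by rewrite -EFinM lee_fin.
Qed.

(** The normalized entropies are shown to converge to the supremum, so the [limn] in
    [entropy_density] is a genuine limit. *)
Lemma entropy_densityE (nu : probability Omega R) : translation_invariant nu ->
  entropy_density nu mu =
  ereal_sup [set (mean nu h - upper_pressure mu h)%:E | h in [set h | local h]].
Proof.
move=> nu_inv; set D := ereal_sup _.
suff : s nu n @[n --> \oo] --> D by move/cvg_lim; apply.
have D_ge h : local h -> ((mean nu h - upper_pressure mu h)%:E <= D)%E.
  by move=> lh; apply: ereal_sup_ubound; exists h.
have lb a : (a%:E < D)%E -> \forall n \near \oo, (a%:E <= s nu n)%E.
  move=> /ereal_sup_gt[_ [h lh <-]]; rewrite lte_fin; exact: entropy_seq_lb.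
move: D_ge lb; case: D => [K||] D_ge lb.
- have hK h : local h -> mean nu h - upper_pressure mu h <= K.
    by move=> /D_ge; rewrite lee_fin.
  have near_lb a : a < K -> \forall n \near \oo, (a%:E <= s nu n)%E.
    by move=> aK; apply: lb; rewrite lte_fin.
  have near_fin : \forall n \near \oo, s nu n \is a fin_num.
    have h1 : K - 1 < K by rewrite ltrBlDr ltrDl.
    have h2 : K < K + 1 by rewrite ltrDl.
    apply: filterS2 (near_lb _ h1) (entropy_seq_ub hK h2) => n a1 a2.
    by rewrite fin_numElt (lt_le_trans _ a1) ?ltNyr// (le_lt_trans a2) ?ltry.
  apply/fine_cvgP; split => //; apply/cvgrPdist_le => e e0.
  have h1 : K - e < K by rewrite ltrBlDr ltrDl.
  have h2 : K < K + e by rewrite ltrDl.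
  apply: filterS3 near_fin (near_lb _ h1) (entropy_seq_ub hK h2) => n sn a1 a2 /=.
  move: a1 a2; rewrite -(fineK sn) !lee_fin /= => a1 a2.
  by rewrite ler_distlC; apply/andP; split.
- by apply/cvgeyPge => a; apply: lb; rewrite ltry.
- have := D_ge (fun=> 0) (local_cst 0).
  by rewrite leeNy_eq.
Qed.

(** Tangency bounds the entropy of [nu] from above by the optimal value [nu(f) - p*(f)] per site,
    while the finite-volume lower bound contains [nu(f) - pressure_seq mu f N]. Comparing the two
    keeps the pressures from falling below their limsup. *)
Lemma tangent_pressure_cvg (nu : probability Omega R) f :
  translation_invariant nu -> local f ->
  (forall h, local h ->
    mean nu h - upper_pressure mu h <= mean nu f - upper_pressure mu f) ->
  pressure_seq mu f n @[n --> \oo] --> upper_pressure mu f.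
Proof.
move=> nu_inv lf hf; have [n fn] := lf.
have cf : continuous f by exact: local_continuous.
apply/cvgrPdist_le => e e0.
have e1 : upper_pressure mu f < upper_pressure mu f + e by rewrite ltrDl.
have := @entropy_ub_cvg (mean nu f - upper_pressure mu f) n.
set K := _ - upper_pressure mu f in hf *.
have e2 : K < K + e by rewrite ltrDl.
move=> /(cvgr_le K)/(_ _ e2) near_ub.
apply: filterS2 (upper_pressure_near cf e1) near_ub => N ub hN.
rewrite ler_distlC; apply/andP; split; last exact: ub.
have := le_trans (rel_entropy_box_lb N nu_inv fn) (rel_entropy_box_ub (N + n) hf).
rewrite lee_fin mulrC -ler_pdivlMr ?boxR_gt0// => /le_trans/(_ hN).
have tr (x p u : R) : x - p <= x - u + e -> u - e <= p by lra.
exact: tr.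
Qed.

End variational_principle.

(** * Oscillations and couplings *)

Section oscillations.
Context {R : realType} {S : pointedFinType} {d : nat}.
Local Notation Omega := (config S d).
Local Notation Zd := 'rV[int]_d.
Implicit Types (f g : Omega -> R).

Lemma osc_ge f i (x y : Omega) : (forall j, j != i -> x j = y j) ->
  ((f x - f y)%:E <= osc f i)%E.
Proof. by move=> xy; apply: ereal_sup_ubound; exists x, y. Qed.

Lemma osc_le f i (a : \bar R) :
  (forall x y : Omega, (forall j, j != i -> x j = y j) -> ((f x - f y)%:E <= a)%E) ->
  (osc f i <= a)%E.
Proof. by move=> h; apply: ge_ereal_sup => _ [x [y [xy ->]]]; exact: h. Qed.

Lemma osc_ge0 f i : (0 <= osc f i)%E.
Proof. by have := @osc_ge f i point point; rewrite subrr; apply. Qed.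

Lemma sum_osc_le_osc1 f (L : {fset Zd}) : (\sum_(i <- L) osc f i <= osc1 f)%E.
Proof.
apply: esum_ge; exists [set` L]; first by split => //; exact: finite_fset.
by rewrite fsbig_finite ?set_fsetK//; exact: finite_fset.
Qed.

Lemma osc1_le f (L : {fset Zd}) (a : Zd -> R) : (forall i, 0 <= a i) ->
  (forall i, i \notin L -> a i = 0) -> (forall i, (osc f i <= (a i)%:E)%E) ->
  (osc1 f <= (\sum_(i <- L) a i)%:E)%E.
Proof.
move=> a0 aL oa; apply: (@le_trans _ _ (\esum_(i in [set: Zd]) (a i)%:E)%E).
  by apply: le_esum => i _; exact: oa.
have -> : (\esum_(i in [set: Zd]) (a i)%:E = \esum_(i in [set` L]) (a i)%:E)%E.
  rewrite [RHS]esum_mkcond; apply: eq_esum => i _; case: ifPn => //.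
  rewrite notin_setE /= => iL; rewrite aL//; exact/negP.
rewrite esum_fset; [|exact: finite_fset|by move=> i _; rewrite lee_fin].
by rewrite fsbig_finite ?set_fsetK -?sumEFin//; exact: finite_fset.
Qed.

Lemma osc1_mono f g : (forall i, (osc f i <= osc g i)%E) -> (osc1 f <= osc1 g)%E.
Proof. by move=> fg; apply: le_esum => i _; exact: fg. Qed.

Lemma osc_fine f i : (osc1 f < +oo)%E -> osc f i = (fine (osc f i))%:E.
Proof.
move=> f1; rewrite fineK//; apply/fin_numPlt.
rewrite (lt_le_trans _ (osc_ge0 _ _)) ?ltNyr//=.
apply: le_lt_trans f1; have := sum_osc_le_osc1 f [fset i]%fset.
by rewrite big_seq_fset1.
Qed.

(** The configurations are interpolated by changing one site at a time; only sites of disagreement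
    contribute. *)
Lemma sum_osc_bound f (s : seq Zd) : (osc1 f < +oo)%E ->
  forall x y : Omega, (forall i, i \notin s -> x i = y i) ->
  f y - f x <= \sum_(i <- s) fine (osc f i) * (x i != y i)%:R.
Proof.
move=> f1; elim: s => [|j s ih] x y xy.
  have -> : x = y by apply/funext => i; exact: xy.
  by rewrite subrr big_nil.
pose z : Omega := fun i => if i == j then y j else x i.
have zy i : i \notin s -> z i = y i.
  by move=> iNs; rewrite /z; case: eqP => [->//|/eqP ij]; rewrite xy// inE negb_or ij.
rewrite big_cons -(subrK (f z) (f y)) -addrA addrC; apply: lerD.
  have [xyj|xyj] := eqVneq (x j) (y j).
    rewrite mulr0 (_ : z = x) ?subrr//; apply/funext => i.
    by rewrite /z; case: eqP => // ->.
  rewrite mulr1 -lee_fin -osc_fine//; apply: osc_ge => i ij.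
  by rewrite /z (negbTE ij).
apply: le_trans (ih z y zy) _; apply: ler_sum => i _.
rewrite ler_wpM2l// ?fine_ge0 ?osc_ge0//.
by rewrite /z; case: (i =P j) => [->|//]; rewrite eqxx.
Qed.

Lemma local_osc_bound f n : depends_on (box_set n) f -> (osc1 f < +oo)%E ->
  forall x y : Omega,
  f y - f x <= \sum_(i <- box d n) fine (osc f i) * (x i != y i)%:R.
Proof.
move=> fn f1 x y; pose z : Omega := fun i => if i \in box d n then y i else x i.
rewrite (fn y z); last by move=> i /in_box ni; rewrite /z ni.
apply: le_trans (@sum_osc_bound f (box d n) f1 x z _) _.
  by move=> i /negbTE iN; rewrite /z iN.
by rewrite le_eqVlt; apply/orP; left; apply/eqP; apply: eq_big_seq => i iN; rewrite /z iN.
Qed.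

Lemma measurable_coord (i : Zd) (a : S) : measurable [set x : Omega | x i = a].
Proof.
apply: local_measurable; exists (rad i) => x y xy /=.
by rewrite xy//; exact: box_set_rad.
Qed.

Lemma measurable_diff (i : Zd) :
  measurable [set x : Omega * Omega | x.1 i != x.2 i].
Proof.
have -> : [set x : Omega * Omega | x.1 i != x.2 i] =
    \bigcup_(a in [set: S])
      ((fst @^-1` [set x : Omega | x i = a]) `&`
       (snd @^-1` (~` [set x : Omega | x i = a]))).
  apply/seteqP; split => [x /= /eqP xi|x [a _ [/= -> h]]].
    by exists (x.1 i) => //; split => //= h; exact: xi.
  by apply/eqP => e; apply: h.
apply: fin_bigcup_measurable => [|a _]; first exact: finite_finset.
apply: measurableI.
  rewrite -[X in measurable X]setTI; apply: measurable_fst => //.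
  exact: measurable_coord.
rewrite -[X in measurable X]setTI; apply: measurable_snd => //.
by apply: measurableC; exact: measurable_coord.
Qed.

Lemma coupling_diff (mu nu : probability Omega R)
    (P : probability (Omega * Omega)%type R) (i : Zd) :
  invariant_coupling mu nu P ->
  P [set x : Omega * Omega | x.1 i != x.2 i] =
  P [set x : Omega * Omega | x.1 0 <> x.2 0].
Proof.
move=> [_ _ Pinv].
have e : [set x : Omega * Omega | x.1 0 <> x.2 0] = [set x | x.1 0 != x.2 0].
  by apply/seteqP; split => x /= /eqP.
rewrite e -(Pinv i); last exact: measurable_diff.
congr (P _); apply/seteqP; split => x /=; by rewrite /shift subrr.
Qed.

Lemma mean_pushforward d1 (T : measurableType d1) (Q : probability T R)
    (h : T -> Omega) (P : probability Omega R) f :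
  measurable_fun setT h -> (forall A, measurable A -> Q (h @^-1` A) = P A) ->
  continuous f -> \int[Q]_x f (h x) = mean P f.
Proof.
move=> mh QP cf; rewrite /mean /Rintegral; congr fine.
have mf := continuous_measurable_config cf.
have ci : Q.-integrable setT (EFin \o (f \o h)).
  apply: measurable_bounded_integrable => //.
  - exact: le_lt_trans (probability_le1 Q measurableT) (ltry _).
  - exact: measurableT_comp.
  - have [M hM] := continuous_bounded_config cf.
    exists M; split; first exact: num_real.
    by move=> x Mx y _ /=; apply: le_trans (hM (h y)) (ltW Mx).
transitivity (\int[pushforward Q h]_x (f x)%:E)%E.
  rewrite (integral_pushforward mh)//.
  exact/measurable_EFinP.
by apply: eq_measure_integral => A mA _; exact: QP.
Qed.

(** Integrate [local_osc_bound] against the coupling; by joint invariance every site disagrees with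
    the same probability as the origin. *)
Lemma coupling_lipschitz (mu nu : probability Omega R)
    (P : probability (Omega * Omega)%type R) f :
  invariant_coupling mu nu P -> local f -> (osc1 f < +oo)%E ->
  mean nu f - mean mu f <=
  fine (osc1 f) * fine (P [set x : Omega * Omega | x.1 0 <> x.2 0]).
Proof.
move=> Pc [n fn] f1; have [P1 P2 _] := Pc.
have cf : continuous f by apply: local_continuous; exists n.
have mf := continuous_measurable_config cf.
have bi (h : Omega * Omega -> R) : measurable_fun setT h ->
    (exists M, forall x, `|h x| <= M) -> P.-integrable setT (EFin \o h).
  move=> mh [M hM]; apply: measurable_bounded_integrable => //.
  - exact: le_lt_trans (probability_le1 P measurableT) (ltry _).
  - exists M; split; first exact: num_real.
    by move=> x Mx y _ /=; apply: le_trans (hM y) (ltW Mx).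
have [M hM] := continuous_bounded_config cf.
have i1 : P.-integrable setT (EFin \o (f \o fst)).
  by apply: bi; [exact: measurableT_comp measurable_fst|exists M => x; exact: hM].
have i2 : P.-integrable setT (EFin \o (f \o snd)).
  by apply: bi; [exact: measurableT_comp measurable_snd|exists M => x; exact: hM].
rewrite -(mean_pushforward measurable_fst P1 cf).
rewrite -(mean_pushforward measurable_snd P2 cf) -RintegralB//.
pose E i := [set x : Omega * Omega | x.1 i != x.2 i].
have mE i : measurable (E i) by exact: measurable_diff.
have iE i : P.-integrable setT (EFin \o (\1_(E i) : _ -> R)).
  apply: bi; first by apply/measurable_indicP.
  by exists 1 => x; rewrite indicE; case: (_ \in _); rewrite ?normr1 ?normr0.
have sumE (s : seq Zd) : P.-integrable setT
      (EFin \o (fun x => \sum_(i <- s) fine (osc f i) * \1_(E i) x)) /\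
    \int[P]_x (\sum_(i <- s) fine (osc f i) * \1_(E i) x) =
    \sum_(i <- s) fine (osc f i) * fine (P [set x : Omega * Omega | x.1 0 <> x.2 0]).
  elim: s => [|i s [ih1 ih2]].
    under [X in _.-integrable _ X]eq_fun do rewrite big_nil.
    rewrite big_nil; split; first exact: finite_measure_integrable_cst.
    by under eq_Rintegral do rewrite big_nil; rewrite Rintegral_cst// mul0r.
  have iZ : P.-integrable setT (EFin \o (fun x => fine (osc f i) * \1_(E i) x)).
    apply: bi.
      by apply: measurable_funM => //; apply/measurable_indicP.
    exists `|fine (osc f i)| => x; rewrite normrM ler_piMr// indicE.
    by case: (_ \in _); rewrite ?normr1 ?normr0.
  split.
    rewrite (_ : _ \o _ = (fun x => (fine (osc f i) * \1_(E i) x)%:E +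
       (\sum_(i <- s) fine (osc f i) * \1_(E i) x)%:E)%E); first exact: integrableD.
    by apply/funext => x; rewrite /= big_cons EFinD.
  under eq_Rintegral do rewrite big_cons.
  rewrite RintegralD// ih2 big_cons RintegralZl//; congr (_ * _ + _).
  rewrite /Rintegral integral_indic ?setIT//.
  exact: (congr1 fine (coupling_diff i Pc)).
apply: (@le_trans _ _ (\int[P]_x (\sum_(i <- box d n) fine (osc f i) * \1_(E i) x))).
  apply: le_Rintegral => //.
  - have := integrableB measurableT i2 i1.
    by apply: eq_integrable => // x _.
  - exact: (sumE _).1.
  - move=> x _; apply: le_trans (local_osc_bound fn f1 x.1 x.2) _.
    rewrite le_eqVlt; apply/orP; left; apply/eqP; apply: eq_bigr => i _.
    congr (_ * _); rewrite indicE; congr (_%:R); congr nat_of_bool.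
    by apply/idP/idP => [xi|/set_mem//]; exact/mem_set.
rewrite (sumE _).2 -mulr_suml ler_wpM2r// ?fine_ge0//.
rewrite -lee_fin fineK; last first.
  apply/fin_numPlt; rewrite f1 andbT.
  have := sum_osc_le_osc1 f fset0; rewrite big_seq_fset0.
  by apply: lt_le_trans; rewrite ltNyr.
rewrite -sumEFin; apply: le_trans (sum_osc_le_osc1 f (box d n)).
by apply: lee_sum => i _; rewrite -osc_fine.
Qed.

End oscillations.

(** * From the transport inequality to the concentration bound *)

Section tangent.
Context {R : realType} {S : pointedFinType} {d : nat}.
Local Notation Omega := (config S d).
Implicit Types (mu nu : probability Omega R) (f g : Omega -> R).

Lemma tangent_measure mu f : local f ->
  exists nu : probability Omega R, translation_invariant nu /\
    forall h, local h ->
      mean nu h - upper_pressure mu h <= mean nu f - upper_pressure mu f.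
Proof.
move=> lf; have cf : continuous f := local_continuous lf.
(* The increment of the upper pressure at [f]; a linear functional below it is a subgradient at [f],
   which yields the claim when evaluated at [h - f]. *)
pose p h := upper_pressure mu (fun x => f x + h x) - upper_pressure mu f.
have lfD h : local h -> local (fun x => f x + h x).
  exact: (local2 (fun u v : R => u + v)).
have cfD h : local h -> continuous ((fun x => f x + h x) : Omega -> R).
  by move=> lh; exact: local_continuous (lfD h lh).
have p_le h a : local h -> (forall x, h x <= a) -> p h <= a.
  move=> lh ha; rewrite /p lerBlDr addrC; apply: upper_pressure_le_add => //.
    exact: cfD.
  move=> e e0; near=> n.
  apply: le_trans (@pressure_seq_le _ _ _ mu n _ f a (cfD h lh) cf _) _.
    by move=> x; rewrite lerD2l.
  by rewrite lerDl ltW.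
have [||||||nu [nu_inv nu_le]] := @invariant_measure_below R S d p.
- rewrite /p (_ : (fun x => _) = f) ?subrr//; apply/funext => x; exact: addr0.
- move=> t h k t01 lh lk; rewrite /p.
  have -> : (fun x => f x + (t * h x + (1 - t) * k x)) =
      (fun x => t * (f x + h x) + (1 - t) * (f x + k x)).
    by apply/funext => x; ring.
  have := upper_pressure_convex mu t01 (cfD h lh) (cfD k lk).
  have tr (u v w z : R) : u <= t * v + (1 - t) * w ->
    u - z <= t * (v - z) + (1 - t) * (w - z) by move=> ?; lra.
  exact: tr.
- by move=> h lh h0; exact: p_le.
- by apply: p_le => //; exact: local_cst.
- by apply: p_le => //; exact: local_cst.
- move=> j h lh; rewrite /p subr_le0; apply: upper_pressure_coboundary => //.
  exact: local_continuous.
exists nu; split; first exact: nu_inv.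
move=> h lh.
have lD : local (fun x => h x - f x) by exact: (local2 (fun u v : R => u - v)).
have := nu_le _ lD; rewrite /p.
have -> : (fun x => f x + (h x - f x)) = h by apply/funext => x; rewrite addrC subrK.
have -> : (fun x => h x - f x) = (fun x => -1 * f x + h x).
  by apply/funext => x; rewrite mulN1r addrC.
rewrite (mean_lin nu (-1) cf (local_continuous lh)).
have tr (u v w z : R) : -1 * v + u <= w - z -> u - w <= v - z by lra.
exact: tr.
Unshelve. all: by end_near. Qed.

End tangent.

(** * Uniform approximation by local functions *)

Section truncation.
Context {R : realType} {S : pointedFinType} {d : nat}.
Local Notation Omega := (config S d).
Implicit Types (f g : Omega -> R).

Definition trunc n (x : Omega) : Omega := fun i => if i \in box d n then x i else point.

Lemma local_trunc n f : local (fun x => f (trunc n x)).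
Proof.
exists n => x y xy; congr f; apply/funext => i; rewrite /trunc.
by case: ifPn => // /in_box; exact: xy.
Qed.

Lemma osc_trunc n f i : (osc (fun x => f (trunc n x)) i <= osc f i)%E.
Proof.
apply: osc_le => x y xy; apply: osc_ge => j ji; rewrite /trunc; case: ifPn => // _.
exact: xy.
Qed.

Lemma trunc_uniform f e : continuous f -> 0 < e ->
  exists n, forall x, `|f (trunc n x) - f x| <= e.
Proof.
move=> cf e0; have e20 : 0 < e / 2 by rewrite divr_gt0.
have /compact_near_coveringP := @config_compact S d.
move=> /(_ nat \oo (fun n x => `|f (trunc n x) - f x| <= e) _)[|n _ hn].
  move=> x _; have : \forall y \near x, `|f x - f y| <= e / 2.
    by have /cvgrPdist_le := cf x; apply.
  move=> /nbhs_cylinder[m hm]; near=> y n => /=.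
  have xy : forall i, box_set m i -> x i = y i by near: y; exact: cylinder_nbhs.
  have mn : (m <= n)%N by near: n; exact: nbhs_infty_ge.
  have h1 : `|f x - f y| <= e / 2 by exact: hm.
  have h2 : `|f x - f (trunc n y)| <= e / 2.
    apply: hm => i mi; rewrite /trunc ifT ?xy//; apply/in_box.
    exact: box_setS mn _ mi.
  have -> : f (trunc n y) - f y = (f x - f y) - (f x - f (trunc n y)) by ring.
  by apply: le_trans (ler_normB _ _) _; rewrite (splitr e) lerD.
by exists n => x; apply: (hn n) => //=.
Unshelve. all: by end_near. Qed.

End truncation.

Lemma third_split_le (R : realFieldType) (e u v x y : R) :
  u - e / 3 <= x -> x <= y + e / 3 -> v <= u + e / 3 -> v - e <= y.
Proof. lra. Qed.

Lemma half_split_le (R : realFieldType) (e u u' m m' a b : R) :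
  u <= u' + e / 2 -> m' <= m + e / 2 -> u' - m' <= a -> a <= b -> u - m <= b + e.
Proof. lra. Qed.

Section gcb_of_dbar.
Context {R : realType} {S : pointedFinType} {d : nat}.
Local Notation Omega := (config S d).
Local Notation Zd := 'rV[int]_d.
Variables (mu : probability Omega R) (g : nat -> nat) (c : nat -> R).
Hypothesis mu_inv : translation_invariant mu.
Hypothesis c0 : forall n, 0 <= c n.
Hypothesis g_cvg : ((g n)%:R / n%:R : R) @[n --> \oo] --> (0 : R).
Hypothesis c_cvg : (c n / #|` box d n|%:R) @[n --> \oo] --> (0 : R).
Hypothesis dec : forall n (j : Zd) A B,
  coord_sigma (translate [set` box d n] j) A ->
  coord_sigma (~` translate [set` box d (n + g n)] j) B ->
  (mu (A `&` B) <= (expR (c n))%:E * (mu A * mu B))%E.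
Variable C : R.
Hypothesis C0 : 0 < C.
Hypothesis dbar_le : forall nu : probability Omega R, translation_invariant nu ->
  (dbar mu nu <= sqrte ((2 * C)%:E * entropy_density nu mu))%E.

Lemma pressure_local_cvg f : local f ->
  pressure_seq mu f n @[n --> \oo] --> upper_pressure mu f.
Proof.
move=> lf; have [nu [nu_inv hnu]] := tangent_measure mu lf.
exact: (tangent_pressure_cvg mu_inv c0 g_cvg c_cvg dec nu_inv lf hnu).
Qed.

(** With [r^2 = 2 C K] the claim is that [(C dl - r)^2 / (2 C)] is nonnegative; here the constant
    [2 C] becomes [C / 2]. *)
Lemma amgm_sqrt (x K dl : R) : 0 <= K -> 0 <= dl ->
  x <= dl * Num.sqrt (2 * C * K) -> x - K <= C / 2 * dl ^+ 2.
Proof.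
move=> K0 dl0; set r := Num.sqrt _ => xr.
have rE : r ^+ 2 = 2 * C * K by rewrite sqr_sqrtr// !mulr_ge0// ltW.
have KE : K = r ^+ 2 / (2 * C) by rewrite rE; field; rewrite gt_eqF.
rewrite lerBlDr; apply: le_trans xr _; rewrite KE -subr_ge0.
have -> : C / 2 * dl ^+ 2 + r ^+ 2 / (2 * C) - dl * r = (C * dl - r) ^+ 2 / (2 * C).
  by field; rewrite gt_eqF.
by rewrite divr_ge0 ?sqr_ge0// mulr_ge0// ltW.
Qed.

Lemma upper_pressure_local_gcb f : local f -> (osc1 f < +oo)%E ->
  upper_pressure mu f - mean mu f <= C / 2 * fine (osc1 f) ^+ 2.
Proof.
move=> lf f1; have [nu [nu_inv hnu]] := tangent_measure mu lf.
set K := mean nu f - upper_pressure mu f in hnu.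
have K0 : 0 <= K.
  have := hnu _ (local_cst (0 : R)); rewrite mean_cst upper_pressure0 subr0; exact.
have entK : (entropy_density nu mu <= K%:E)%E.
  rewrite (entropy_densityE mu_inv c0 g_cvg c_cvg dec nu_inv).
  by apply: ge_ereal_sup => _ [h lh <-]; rewrite lee_fin; exact: hnu.
have dK : (dbar mu nu <= (Num.sqrt (2 * C * K))%:E)%E.
  apply: le_trans (dbar_le nu_inv) _.
  have : ((2 * C)%:E * entropy_density nu mu <= (2 * C * K)%:E)%E.
    rewrite (EFinM (2 * C) K); apply: lee_wpmul2l; last exact: entK.
    by rewrite lee_fin mulr_ge0// ltW.
  case: (_ * entropy_density nu mu)%E => [r| |]; rewrite /sqrte.
  - by rewrite !lee_fin => rK; exact: ler_wsqrtr.
  - by rewrite leye_eq.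
  - by rewrite lee_fin sqrtr_ge0.
have f10 : (0 <= osc1 f)%E.
  by have := sum_osc_le_osc1 f fset0; rewrite big_seq_fset0.
have lip : mean nu f - mean mu f <= fine (osc1 f) * Num.sqrt (2 * C * K).
  apply/ler_addgt0Pr => e e0.
  (* The infimum in [dbar] need not be attained here, so a coupling within [e'] is taken; the added
     1 covers total oscillation 0. *)
  pose e' := e / (fine (osc1 f) + 1).
  have e'0 : 0 < e' by rewrite divr_gt0// ltr_wpDl// fine_ge0.
  have : (dbar mu nu < (Num.sqrt (2 * C * K) + e')%:E)%E.
    by apply: le_lt_trans dK _; rewrite lte_fin ltrDl.
  move=> /ereal_inf_lt[_ [P Pc <-]] Pe.
  apply: le_trans (coupling_lipschitz Pc lf f1) _.
  have Pfin : P [set x : Omega * Omega | x.1 0 <> x.2 0] \is a fin_num.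
    by rewrite ge0_fin_numE// (lt_trans Pe)// ltry.
  move: Pe; rewrite -(fineK Pfin) lte_fin /= => Pe.
  apply: le_trans (ler_wpM2l (fine_ge0 f10) (ltW Pe)) _.
  rewrite mulrDr lerD2l /e' mulrCA ler_piMr// ?(ltW e0)//.
  by rewrite ler_pdivrMr ?mul1r ?lerDl// ltr_wpDl// fine_ge0.
have := amgm_sqrt K0 (fine_ge0 f10) lip; rewrite /K.
have tr (x u v w : R) : x - u - (x - v) <= w -> v - u <= w by lra.
exact: tr.
Qed.

Lemma gcb_of_dbar : thermodynamic_gcb mu C.
Proof.
move=> f [cf f1].
have approx e : 0 < e -> exists fe, [/\ local fe, forall x, fe x <= f x + e,
    forall x, f x <= fe x + e & (osc1 fe <= osc1 f)%E].
  move=> e0; have [n hn] := trunc_uniform cf e0.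
  exists (fun x => f (trunc n x)); split; first exact: local_trunc.
  - by move=> x; rewrite addrC -lerBlDr; apply: le_trans (ler_norm _) (hn x).
  - move=> x; rewrite addrC -lerBlDr; apply: le_trans (hn x).
    by rewrite distrC ler_norm.
  - by apply: osc1_mono => i; exact: osc_trunc.
(* Pressures are 1-Lipschitz in the supremum norm uniformly in the volume, so both convergence and
   the bound survive uniform limits. *)
have up_le (h k : Omega -> R) (e : R) : continuous h -> continuous k -> 0 < e ->
    (forall x, h x <= k x + e) -> upper_pressure mu h <= upper_pressure mu k + e.
  move=> ch ck e0 hk; apply: upper_pressure_le_add => // e' e'0; near=> n.
  by apply: le_trans (pressure_seq_le mu n ch ck hk) _; rewrite lerDl ltW.
have pcvg : pressure_seq mu f n @[n --> \oo] --> upper_pressure mu f.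
  apply/cvgrPdist_le => e e0; have e30 : 0 < e / 3 by rewrite divr_gt0.
  have [fe [lfe fef ffe _]] := approx _ e30.
  have cfe := local_continuous lfe.
  have /cvgrPdist_le/(_ _ e30) near_fe := pressure_local_cvg lfe.
  have ue : upper_pressure mu f < upper_pressure mu f + e by rewrite ltrDl.
  apply: filterS2 near_fe (upper_pressure_near cf ue) => n h1 h2.
  rewrite ler_distlC; apply/andP; split; last exact: h2.
  move: h1; rewrite ler_distlC => /andP[h1 _].
  have h3 := pressure_seq_le mu n cfe cf fef.
  have h4 := up_le _ _ _ cf cfe e30 ffe.
  exact: third_split_le h1 h3 h4.
split; first by apply/cvg_ex; exists (upper_pressure mu f).
have -> : pressure mu (fun x => f x - mean mu f) = upper_pressure mu f - mean mu f.
  rewrite /pressure (_ : pressure_seq _ _ = fun n => pressure_seq mu f n - mean mu f).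
    by apply/cvg_lim => //; apply: cvgB => //; exact: cvg_cst.
  by apply/funext => n; exact: pressure_seq_cst.
apply/ler_addgt0Pr => e e0; have e20 : 0 < e / 2 by rewrite divr_gt0.
have [fe [lfe fef ffe o1]] := approx _ e20.
have cfe := local_continuous lfe.
have h1 := up_le _ _ _ cf cfe e20 ffe.
have h2 : mean mu fe <= mean mu f + e / 2.
  rewrite -[X in _ + X](mean_cst mu) -meanD//; last exact: cont_cst.
  by apply: mean_le => //; apply: contD => //; exact: cont_cst.
have h3 := upper_pressure_local_gcb lfe (le_lt_trans o1 f1).
have fe10 : (0 <= osc1 fe)%E.
  by have := sum_osc_le_osc1 fe fset0; rewrite big_seq_fset0.
have h4 : C / 2 * fine (osc1 fe) ^+ 2 <= C / 2 * fine (osc1 f) ^+ 2.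
  have ff : osc1 f \is a fin_num by rewrite ge0_fin_numE// (le_trans fe10).
  have ffe' : osc1 fe \is a fin_num by rewrite ge0_fin_numE// (le_lt_trans o1).
  apply: ler_wpM2l; first by rewrite divr_ge0// ltW.
  apply: lerXn2r; rewrite ?nnegrE ?fine_ge0//; first exact: le_trans o1.
  exact: fine_le.
exact: half_split_le h1 h2 h3 h4.
Unshelve. all: by end_near. Qed.

End gcb_of_dbar.

(** * Kantorovich duality for invariant couplings *)

(** Pairs of letters become an alphabet, so pairs of configurations form a configuration space to
    which [invariant_measure_below] applies. *)
HB.instance Definition _ (S S' : pointedFinType) := Pointed.on (S * S')%type.

Section coupling.
Context {R : realType} {S : pointedFinType} {d : nat}.
Local Notation Omega := (config S d).
Local Notation Omega2 := (config (S * S)%type d).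
Local Notation Zd := 'rV[int]_d.
Implicit Types (f g : Omega -> R).

Definition left_config (z : Omega2) : Omega := fun i => (z i).1.
Definition right_config (z : Omega2) : Omega := fun i => (z i).2.
Definition pair_config (x y : Omega) : Omega2 := fun i => (x i, y i).
Definition disagree (z : Omega2) : R := ((z 0).1 != (z 0).2)%:R.
Definition box_mean (T : pointedFinType) N (h : config T d -> R) (z : config T d) : R :=
  box_sum N h z / #|` box d N|%:R.

Lemma local_left A (f : Omega -> A) : local f -> local (fun z => f (left_config z)).
Proof.
by move=> [n fn]; exists n => x y xy; apply: fn => i ni; rewrite /left_config xy.
Qed.

Lemma local_right A (f : Omega -> A) : local f -> local (fun z => f (right_config z)).
Proof.
by move=> [n fn]; exists n => x y xy; apply: fn => i ni; rewrite /right_config xy.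
Qed.

Lemma measurable_left : measurable_fun setT left_config.
Proof.
apply: continuous_measurable_map => x U /nbhs_cylinder[n hn].
by apply: filterS (cylinder_nbhs n x) => y xy; apply: hn => i ni; rewrite /left_config xy.
Qed.

Lemma measurable_right : measurable_fun setT right_config.
Proof.
apply: continuous_measurable_map => x U /nbhs_cylinder[n hn].
by apply: filterS (cylinder_nbhs n x) => y xy; apply: hn => i ni; rewrite /right_config xy.
Qed.

Definition split_config (z : Omega2) : Omega * Omega := (left_config z, right_config z).

Lemma measurable_split : measurable_fun setT split_config.
Proof. by apply: measurable_fun_pair; [exact: measurable_left|exact: measurable_right]. Qed.

HB.instance Definition _ := isMeasurableFun.Build _ _ _ _ split_config measurable_split.

Lemma local_disagree : local disagree.
Proof.
exists 0%N => x y xy; rewrite /disagree xy// => k; by rewrite mxE.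
Qed.

Lemma local_box_mean (T : pointedFinType) N (h : config T d -> R) :
  local h -> local (box_mean N h).
Proof.
move=> lh; apply: (local_comp (fun u : R => u / _)).
by apply: local_sum => i; exact: local_shift.
Qed.

Lemma box_mean_lin (T : pointedFinType) N a b (h k : config T d -> R) z :
  box_mean N (fun x => a * h x + b * k x) z = a * box_mean N h z + b * box_mean N k z.
Proof. by rewrite /box_mean box_sum_lin mulrDl !mulrA. Qed.

Lemma box_mean_cst (T : pointedFinType) N a (z : config T d) :
  box_mean N (fun=> a) z = a.
Proof.
rewrite /box_mean /box_sum big_const_seq count_predT iter_addr_0 -[a *+ _]mulr_natl.
by rewrite mulrAC divff ?mul1r// gt_eqF// boxR_gt0.
Qed.

Lemma box_mean_le (T : pointedFinType) N (h k : config T d -> R) z :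
  (forall x, h x <= k x) -> box_mean N h z <= box_mean N k z.
Proof. by move=> hk; rewrite ler_wpM2r ?invr_ge0//; apply: ler_sum => i _. Qed.

Lemma mean_box_mean (mu : probability Omega R) N f :
  translation_invariant mu -> continuous f -> mean mu (box_mean N f) = mean mu f.
Proof.
move=> mu_inv cf; rewrite /box_mean.
under eq_fun do rewrite mulrC.
rewrite meanZ; last exact: cont_box_sum.
by rewrite mean_box_sum// mulKf// gt_eqF// boxR_gt0.
Qed.

Variables (mu nu : probability Omega R) (D : R).
Hypothesis mu_inv : translation_invariant mu.
Hypothesis nu_inv : translation_invariant nu.
(** The single-site condition expresses that [f] is [t]-Lipschitz for the normalized Hamming
    distance on the box, so its total oscillation is at most [t]. *)
Hypothesis D_lip : forall N (t : R) f, 0 <= t -> depends_on (box_set N) f ->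
  (forall i (x y : Omega), (forall j, j != i -> x j = y j) ->
    f x - f y <= t / #|` box d N|%:R) ->
  mean nu f - mean mu f <= D * t.

(* Kantorovich duality on a box: the infimal convolution of [f] with the
   normalized Hamming distance lies between [b - g] and [f]. *)
Lemma kantorovich_box N (t b : R) f g : 0 <= t -> local f -> local g ->
  (forall z : Omega2,
    b <= f (left_config z) + g (right_config z) + t * box_mean N disagree z) ->
  b <= mean mu f + mean nu g + D * t.
Proof.
move=> t0 lf lg hb.
have cf : continuous f := local_continuous lf.
have cg : continuous g := local_continuous lg.
have [Mf hf] := continuous_bounded_config cf.
pose dist x y := box_mean N disagree (pair_config x y).
have dist_ge0 x y : 0 <= dist x y.
  by rewrite /dist /box_mean mulr_ge0 ?invr_ge0// /box_sum sumr_ge0.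
pose vals y := [set f x + t * dist x y | x in [set: Omega]].
pose phi y := inf (vals y).
have vals_ne y : vals y !=set0 by exists (f point + t * dist point y), point.
have vals_lb y : has_lbound (vals y).
  exists (- Mf) => _ [x _ <-].
  rewrite -[leLHS]addr0; apply: lerD; last exact: mulr_ge0.
  by have := hf x; rewrite ler_norml => /andP[].
have phi_le x y : phi y <= f x + t * dist x y by apply: ge_inf => //; exists x.
have phi_ge y a : (forall x, a <= f x + t * dist x y) -> a <= phi y.
  by move=> ha; apply: lb_le_inf => // _ [x _ <-]; exact: ha.
(* Translating by [i] brings the site [- i] to the origin; the box is symmetric, so the same sites
   are counted. *)
have distE x y : dist x y =
    (\sum_(i <- box d N) (x (- i) != y (- i))%:R) / #|` box d N|%:R.
  rewrite /dist /box_mean /box_sum; congr (_ / _); apply: eq_bigr => i _.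
  by rewrite /disagree /shift /= sub0r.
have phi_dep : depends_on (box_set N) phi.
  have sub x y : (forall i, box_set N i -> x i = y i) -> phi x <= phi y.
    move=> xy; apply: phi_ge => u; apply: le_trans (phi_le u x) _.
    rewrite !distE le_eqVlt; apply/orP; left; apply/eqP; congr (_ + _ * (_ / _)).
    apply: eq_big_seq => i /in_box iN; rewrite xy//; exact: box_setN.
  by move=> x y xy; apply/le_anti; rewrite !sub// => i /xy.
have phi_lip i (x y : Omega) : (forall j, j != i -> x j = y j) ->
    phi x - phi y <= t / #|` box d N|%:R.
  move=> xy; rewrite lerBlDr addrC -lerBlDr; apply: phi_ge => u.
  rewrite lerBlDr; apply: le_trans (phi_le u x) _; rewrite -addrA lerD2l.
  suff H : dist u x <= dist u y + 1 / #|` box d N|%:R.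
    by apply: le_trans (ler_wpM2l t0 H) _; rewrite mulrDr mul1r.
  rewrite !distE -mulrDl ler_wpM2r ?invr_ge0//.
  have [iN|iN] := boolP (- i \in box d N); last first.
    rewrite -[leLHS]addr0 lerD// le_eqVlt; apply/orP; left; apply/eqP.
    apply: eq_big_seq => j jN; rewrite xy//.
    by apply: contraNneq iN => <-; rewrite opprK.
  rewrite !(big_rem _ iN)/= addrAC; apply: lerD.
    by case: (u _ != x _); case: (u _ != y _); rewrite ?add0r ?lerDr ?addr_ge0.
  rewrite le_eqVlt; apply/orP; left; apply/eqP; apply: eq_big_seq => j.
  rewrite (mem_rem_uniq _ (fset_uniq _)) !inE => /andP[ji _]; rewrite xy//.
  by apply: contraNneq ji => <-; rewrite opprK.
have lphi : local phi by exists N.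
have cphi : continuous phi := local_continuous lphi.
have phif : mean mu phi <= mean mu f.
  apply: mean_le => // x; apply: le_trans (phi_le x x) _.
  by rewrite distE big1 ?mul0r ?mulr0 ?addr0// => i _; rewrite eqxx.
have gphi : b - mean nu g <= mean nu phi.
  rewrite -(mean_cst nu b).
  have -> : mean nu (fun=> b) - mean nu g = mean nu (fun x => -1 * g x + b).
    by rewrite mean_lin//; [rewrite mulN1r addrC|exact: cont_cst].
  apply: mean_le => //; first by apply: contD; [exact: contZ|exact: cont_cst].
  move=> y; apply: phi_ge => x; have := hb (pair_config x y).
  have tr (u v w : R) : b <= u + v + w -> -1 * v + b <= u + w by lra.
  exact: tr.
have := D_lip t0 phi_dep phi_lip.
have tr (u v w z k : R) : u <= w -> b - v <= z -> z - u <= k -> b <= w + v + k by lra.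
exact: tr.
Qed.

(* Upper bounds for the cost of [h] by dual pairs [(f, g)] and multiples of the
   normalized Hamming distance, after averaging [h] over a large box; averaging
   makes the infimum vanish on coboundaries. *)
Definition transport_bounds (h : Omega2 -> R) := [set a : R | \forall N \near \oo,
  exists f g t, [/\ local f, local g, 0 <= t,
    forall z, box_mean N h z <=
      f (left_config z) + g (right_config z) + t * box_mean N disagree z &
    mean mu f + mean nu g + D * t <= a]].

Local Notation Q := transport_bounds.

(** Weak duality, from [kantorovich_box]; it keeps the infimum [q] finite and gives [q 0 >= 0]. *)
Let Q_lb h a b : (forall z, b <= h z) -> Q h a -> b <= a.
Proof.
move=> bh [N _ /(_ N (leqnn N))[f [g [t [lf lg t0 hle ha]]]]].
apply: le_trans ha; apply: (@kantorovich_box N) => // z.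
by apply: le_trans (hle z); rewrite -[b](box_mean_cst N b z); exact: box_mean_le.
Qed.

Let Q_cst h b : (forall z, h z <= b) -> Q h b.
Proof.
move=> hb; near=> N; exists (fun=> b), (fun=> 0), 0.
split=> //; [exact: local_cst|exact: local_cst| |].
  by move=> z; rewrite mul0r !addr0 -[b](box_mean_cst N b z); exact: box_mean_le.
by rewrite !mean_cst mulr0 !addr0.
Unshelve. all: by end_near. Qed.

Let Q_inf h : local h -> has_inf (Q h).
Proof.
move=> lh; have [M hM] := continuous_bounded_config (local_continuous lh).
split.
  by exists M; apply: Q_cst => z; apply: le_trans (hM z); exact: ler_norm.
exists (- M) => a; apply: Q_lb => z.
by have := hM z; rewrite ler_norml => /andP[].
Qed.

Let q h := inf (Q h).

Let q_le h a : local h -> Q h a -> q h <= a.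
Proof. by move=> lh Qa; apply: ge_inf => //; exact: (Q_inf lh).2. Qed.

Lemma coupling_functional_measure : exists P : probability Omega2 R,
  translation_invariant P /\ forall h a, local h -> Q h a -> mean P h <= a.
Proof.
have [||||||P [P_inv hP]] := @invariant_measure_below R (S * S)%type d q.
- apply/le_anti/andP; split; first by apply: q_le; [exact: local_cst|exact: Q_cst].
  apply: lb_le_inf; first exact: (Q_inf (local_cst 0)).1.
  by move=> a; exact: Q_lb.
- move=> t h k t01 lh lk; have /andP[t0 t1] := t01.
  have t1' : 0 <= 1 - t by rewrite subr_ge0.
  have lhk : local (fun x => t * h x + (1 - t) * k x).
    exact: (local2 (fun u v : R => t * u + (1 - t) * v)).
  apply/ler_addgt0Pr => e e0.
  have [a Qa ae] := inf_adherent e0 (Q_inf lh).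
  have [b Qb be] := inf_adherent e0 (Q_inf lk).
  apply: le_trans (convex_comb_le t01 (ltW ae) (ltW be)).
  apply: q_le => //; apply: filterS2 Qa Qb => N.
  move=> [f [g [r [lf lg r0 hle ha]]]] [f' [g' [r' [lf' lg' r0' hle' ha']]]].
  exists (fun x => t * f x + (1 - t) * f' x), (fun x => t * g x + (1 - t) * g' x),
    (t * r + (1 - t) * r'); split.
  + exact: (local2 (fun u v : R => t * u + (1 - t) * v)).
  + exact: (local2 (fun u v : R => t * u + (1 - t) * v)).
  + by rewrite addr_ge0// mulr_ge0.
  + move=> z; rewrite box_mean_lin.
    have := lerD (ler_wpM2l t0 (hle z)) (ler_wpM2l t1' (hle' z)).
    move=> /le_trans; apply; rewrite le_eqVlt; apply/orP; left; apply/eqP; ring.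
  + have c1 (u : Omega -> R) : local u -> continuous u by exact: local_continuous.
    have mlin (m : probability Omega R) u v : local u -> local v ->
        mean m (fun x => t * u x + (1 - t) * v x) = t * mean m u + (1 - t) * mean m v.
      move=> lu lv; rewrite meanD; [|apply: contZ; exact: c1..].
      by rewrite (meanZ m t (c1 _ lu)) (meanZ m (1 - t) (c1 _ lv)).
    rewrite (mlin mu _ _ lf lf') (mlin nu _ _ lg lg').
    have := lerD (ler_wpM2l t0 ha) (ler_wpM2l t1' ha').
    apply: le_trans; rewrite le_eqVlt; apply/orP; left; apply/eqP.
    move: (mean mu f) (mean mu f') (mean nu g) (mean nu g') => m1 m2 m3 m4; ring.
- by move=> h lh h0; apply: q_le => //; exact: Q_cst.
- by apply: q_le; [exact: local_cst|exact: Q_cst].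
- by apply: q_le; [exact: local_cst|exact: Q_cst].
- move=> j h lh; have lD : local (fun z => h (shift j z) - h z).
    by apply: (local2 (fun u v : R => u - v)) => //; exact: local_shift.
  apply/ler_addgt0Pr => e e0; rewrite add0r; apply: q_le => //.
  have [M hM] := continuous_bounded_config (local_continuous lh).
  have /cvgrPdist_le/(_ _ e0) := @box_excess_cvg R d (rad j) (2 * M).
  apply: filterS => N; rewrite sub0r normrN => hN.
  (* For large boxes the averaged coboundary is below the constant [e], so this pair, without any
     use of the distance, has cost [e]. *)
  exists (fun=> e), (fun=> 0), 0; split => //; [exact: local_cst|exact: local_cst| |].
    move=> z; rewrite mul0r !addr0; apply: le_trans (le_trans (ler_norm _) hN).
    rewrite /box_mean ler_wpM2r ?invr_ge0//.
    have := @box_shift_sum d R N j (fun i => h (shift i z)) M (fun i => hM _).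
    apply: le_trans; apply: le_trans (ler_norm _); rewrite -sumrB.
    by rewrite le_eqVlt; apply/orP; left; apply/eqP; apply: eq_bigr => i _;
      rewrite shiftD (addrC j).
  by rewrite !mean_cst mulr0 !addr0.
exists P; split; first exact: P_inv.
by move=> h a lh Qa; apply: le_trans (hP h lh) _; exact: q_le.
Qed.

(** For a function of one coordinate, its box mean paired with 0 is an exact dual pair, and so is
    its opposite; the bounds for both signs fix the marginals. *)
Lemma coupling_exists : exists P : probability (Omega * Omega)%type R,
  invariant_coupling mu nu P /\
  (P [set x : Omega * Omega | x.1 0%R <> x.2 0%R] <= D%:E)%E.
Proof.
have [P [P_inv hP]] := coupling_functional_measure.
have neg_le (h : Omega2 -> R) a : local h -> Q h a -> Q (fun z => -1 * h z) (- a) ->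
    mean P h = a.
  move=> lh Qa QNa; apply/le_anti; rewrite hP//=.
  have := hP _ _ (local_comp (fun u => -1 * u) lh) QNa.
  by rewrite meanZ ?mulN1r ?lerN2//; exact: local_continuous.
have QN (h : Omega2 -> R) (f : Omega -> R) (g : Omega -> R) : local f -> local g ->
    (forall N z, box_mean N h z =
      box_mean N f (left_config z) + box_mean N g (right_config z)) ->
    Q h (mean mu f + mean nu g).
  move=> lf lg hE; near=> N; exists (box_mean N f), (box_mean N g), 0.
  split => //; [exact: local_box_mean|exact: local_box_mean| |].
    by move=> z; rewrite mul0r addr0 hE.
  by rewrite mulr0 addr0 !mean_box_mean//; exact: local_continuous.
have P1 f : local f -> mean P (fun z => f (left_config z)) = mean mu f.
  move=> lf; apply: neg_le; first exact: local_left.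
    have := @QN (fun z => f (left_config z)) f (fun=> 0) lf (local_cst _).
    rewrite mean_cst addr0; apply => N z.
    by rewrite box_mean_cst addr0.
  have lNf : local (fun x => -1 * f x) by exact: (local_comp (fun u : R => -1 * u) lf).
  have := @QN (fun z => -1 * f (left_config z))
    (fun x => -1 * f x) (fun=> 0) lNf (local_cst _).
  rewrite mean_cst addr0 meanZ ?mulN1r; last exact: local_continuous.
  by apply => N z; rewrite box_mean_cst addr0.
have P2 f : local f -> mean P (fun z => f (right_config z)) = mean nu f.
  move=> lf; apply: neg_le; first exact: local_right.
    have := @QN (fun z => f (right_config z)) (fun=> 0) f (local_cst _) lf.
    rewrite mean_cst add0r; apply => N z.
    by rewrite box_mean_cst add0r.
  have lNf : local (fun x => -1 * f x) by exact: (local_comp (fun u : R => -1 * u) lf).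
  have := @QN (fun z => -1 * f (right_config z))
    (fun=> 0) (fun x => -1 * f x) (local_cst _) lNf.
  rewrite mean_cst add0r meanZ ?mulN1r; last exact: local_continuous.
  by apply => N z; rewrite box_mean_cst add0r.
have Prho : mean P disagree <= D.
  apply: hP; first exact: local_disagree.
  (* The averaged disagreement is itself the distance term with [t = 1], at cost [D]. *)
  near=> N; exists (fun=> 0), (fun=> 0), 1; split => //;
    [exact: local_cst|exact: local_cst|by move=> z; rewrite !add0r mul1r|].
  by rewrite !mean_cst !add0r mulr1.
exists (distribution P split_config); split; last first.
  have lE : local [set z : Omega2 | (z 0).1 <> (z 0).2].
    exists 0%N => x y xy /=; rewrite (xy 0)// => k; by rewrite mxE.
  have mE := local_measurable lE.
  change (P [set z : Omega2 | (z 0%R).1 <> (z 0%R).2] <= D%:E)%E.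
  have disE : disagree = \1_[set z : Omega2 | (z 0).1 <> (z 0).2].
    apply/funext => z; rewrite indicE /disagree; congr (_%:R); congr nat_of_bool.
    by apply/idP/idP => [/eqP h|/set_mem h]; [exact/mem_set|exact/eqP].
  move: Prho; rewrite disE mean_indic// -lee_fin fineK//.
  exact: fin_num_measure.
(* A law on configurations is determined by local events, hence by its means of local functions. *)
have marg (m : probability Omega R) (h : Omega2 -> Omega) (mh : measurable_fun setT h) :
    (forall A : Omega -> Prop, local A -> local (h @^-1` A)) ->
    (forall f, local f -> mean P (fun z => f (h z)) = mean m f) ->
    forall A, measurable A -> P (h @^-1` A) = m A.
  move=> hl hm A mA; apply/esym.
  apply: (@probability_local_unique R S d m
    (measure_function_pushforward__canonical__measure_function_Measure P mh)) => // B lB.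
  have mB := local_measurable lB.
  have mhB := local_measurable (hl _ lB).
  rewrite /= /pushforward -(fineK (fin_num_measure m _ mB)).
  rewrite -(fineK (fin_num_measure P _ mhB)); congr EFin.
  rewrite -mean_indic// -mean_indic// -hm; last exact: local_indic.
  by congr (mean P _); apply/funext => z; rewrite !indicE.
split.
- exact: (marg mu left_config measurable_left (@local_left Prop) P1).
- exact: (marg nu right_config measurable_right (@local_right Prop) P2).
- move=> i A mA; rewrite /distribution /pushforward.
  have mA' : measurable (split_config @^-1` A).
    by rewrite -[X in measurable X]setTI; exact: measurable_split.
  exact: (P_inv i _ mA').
Unshelve. all: by end_near. Qed.

End coupling.

(** * From the concentration bound to the transport inequality *)

Lemma quadratic_bound_sqrt (R : rcfType) (C s t x : R) : 0 < C -> 0 <= s -> 0 <= t ->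
  (forall l, 0 < l -> l * x <= s + C / 2 * (l * t) ^+ 2) ->
  x <= Num.sqrt (2 * C * s) * t.
Proof.
move=> C0 s0 t0 h; have [x0|x0] := lerP x 0.
  by apply: le_trans x0 _; rewrite mulr_ge0// sqrtr_ge0.
move: t0; rewrite le_eqVlt => /predU1P[te|t0].
  (* When [t = 0] the quadratic term disappears, and this [l] would give [s + 1 <= s]. *)
  have := h ((s + 1) / x) (divr_gt0 (ltr_wpDl s0 ltr01) x0).
  by rewrite -te divfK ?gt_eqF// mulr0 expr0n/= mulr0 addr0 gerDl ler10.
(* The maximizer of [l x - C (l t)^2 / 2]; its value is [x^2 / (2 C t^2)]. *)
have l0 : 0 < x / (C * t ^+ 2) by rewrite divr_gt0// mulr_gt0// exprn_gt0.
have := h _ l0.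
have -> : C / 2 * (x / (C * t ^+ 2) * t) ^+ 2 = x ^+ 2 / (2 * (C * t ^+ 2)).
  by field; rewrite !gt_eqF.
have -> : x / (C * t ^+ 2) * x =
    x ^+ 2 / (2 * (C * t ^+ 2)) + x ^+ 2 / (2 * (C * t ^+ 2)).
  by field; rewrite !gt_eqF.
rewrite lerD2r ler_pdivrMr ?mulr_gt0 ?exprn_gt0// => hx.
rewrite -[x](ger0_norm (ltW x0)) -[t](ger0_norm (ltW t0)) -!sqrtr_sqr -sqrtrM.
  apply: ler_wsqrtr; apply: le_trans hx _.
  by rewrite le_eqVlt; apply/orP; left; apply/eqP; ring.
by rewrite !mulr_ge0// ltW.
Qed.

Section dbar_of_gcb.
Context {R : realType} {S : pointedFinType} {d : nat}.
Local Notation Omega := (config S d).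
Local Notation Zd := 'rV[int]_d.
Variables (mu : probability Omega R) (g : nat -> nat) (c : nat -> R).
Hypothesis mu_inv : translation_invariant mu.
Hypothesis c0 : forall n, 0 <= c n.
Hypothesis g_cvg : ((g n)%:R / n%:R : R) @[n --> \oo] --> (0 : R).
Hypothesis c_cvg : (c n / #|` box d n|%:R) @[n --> \oo] --> (0 : R).
Hypothesis dec : forall n (j : Zd) A B,
  coord_sigma (translate [set` box d n] j) A ->
  coord_sigma (~` translate [set` box d (n + g n)] j) B ->
  (mu (A `&` B) <= (expR (c n))%:E * (mu A * mu B))%E.
Variable C : R.
Hypothesis C0 : 0 < C.
Hypothesis gcb : thermodynamic_gcb mu C.

Lemma upper_pressure_gcb f t : local f -> 0 <= t -> (osc1 f <= t%:E)%E ->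
  upper_pressure mu f - mean mu f <= C / 2 * t ^+ 2.
Proof.
move=> lf t0 ft; have cf : continuous f := local_continuous lf.
have Df : Delta1 f by split => //; exact: le_lt_trans ft (ltry _).
have [pf pb] := gcb Df.
have pE : pressure mu (fun x => f x - mean mu f) = pressure mu f - mean mu f.
  rewrite {1}/pressure (_ : pressure_seq _ _ = fun n => pressure_seq mu f n - mean mu f).
    by apply/cvg_lim => //; apply: cvgB => //; exact: cvg_cst.
  by apply/funext => n; exact: pressure_seq_cst.
have up : upper_pressure mu f <= pressure mu f.
  apply/ler_addgt0Pr => e e0; apply: upper_pressure_le => //.
  have /cvgrPdist_le/(_ _ e0) := pf; apply: filterS => n.
  by rewrite distrC ler_distl => /andP[].
apply: le_trans (_ : _ <= pressure mu f - mean mu f) _; first by rewrite lerD2r.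
rewrite -pE; apply: le_trans pb _; rewrite ler_wpM2l ?divr_ge0 ?(ltW C0)//.
have f10 : (0 <= osc1 f)%E.
  by have := sum_osc_le_osc1 f fset0; rewrite big_seq_fset0.
apply: lerXn2r; rewrite ?nnegrE ?fine_ge0//.
by rewrite -lee_fin fineK// ge0_fin_numE// (le_lt_trans ft)// ltry.
Qed.

Lemma gcb_lipschitz (nu : probability Omega R) (s : R) : translation_invariant nu ->
  entropy_density nu mu = s%:E -> 0 <= s ->
  forall N (t : R) f, 0 <= t -> depends_on (box_set N) f ->
  (forall i (x y : Omega), (forall j, j != i -> x j = y j) ->
    f x - f y <= t / #|` box d N|%:R) ->
  mean nu f - mean mu f <= Num.sqrt (2 * C * s) * t.
Proof.
move=> nu_inv sE s0 N t f t0 fN flip.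
have lf : local f by exists N.
apply: quadratic_bound_sqrt => // l l0.
pose h x := l * f x; have lh : local h by exact: (local_comp (fun u : R => l * u) lf).
have oh : (osc1 h <= (l * t)%:E)%E.
  (* Each site of the box contributes at most [l t / |Lambda_N|] and the others nothing, so the
     total is [l t]. *)
  pose a (i : Zd) := if i \in box d N then l * t / #|` box d N|%:R else 0.
  have lt0 : 0 <= l * t by rewrite mulr_ge0// ltW.
  apply: le_trans (@osc1_le _ _ _ h (box d N) a _ _ _) _.
  - by move=> i; rewrite /a; case: ifPn => // _; rewrite divr_ge0.
  - by move=> i; rewrite /a => /negbTE ->.
  - move=> i; apply: osc_le => x y xy; rewrite lee_fin /a /h -mulrBr.
    case: ifPn => iN; first by rewrite -mulrA ler_wpM2l// ?(ltW l0)//; exact: flip xy.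
    rewrite (fN x y) ?subrr ?mulr0// => j /in_box jN; apply: xy.
    by apply: contraNneq iN => <-.
  - rewrite lee_fin big_seq (eq_bigr (fun=> l * t / #|` box d N|%:R)); last first.
      by move=> i iN; rewrite /a iN.
    rewrite -big_seq big_const_seq count_predT iter_addr_0 -[_ *+ _]mulr_natr.
    by rewrite divfK// gt_eqF// boxR_gt0.
have h1 := upper_pressure_gcb lh (mulr_ge0 (ltW l0) t0) oh.
have h2 : mean nu h - upper_pressure mu h <= s.
  rewrite -lee_fin -sE (entropy_densityE mu_inv c0 g_cvg c_cvg dec nu_inv).
  by apply: ereal_sup_ubound; exists h.
have cf : continuous f := local_continuous lf.
rewrite mulrBr -(meanZ nu l cf) -(meanZ mu l cf).
have tr (u v w b : R) : u - v <= b -> w - u <= s -> w - v <= s + b by lra.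
exact: tr h1 h2.
Qed.

Lemma dbar_of_gcb (nu : probability Omega R) : translation_invariant nu ->
  (dbar mu nu <= sqrte ((2 * C)%:E * entropy_density nu mu))%E.
Proof.
move=> nu_inv.
have ent0 : (0 <= entropy_density nu mu)%E.
  rewrite (entropy_densityE mu_inv c0 g_cvg c_cvg dec nu_inv).
  apply: ereal_sup_ubound; exists (fun=> 0); first exact: local_cst.
  by rewrite mean_cst upper_pressure0 subrr.
case sE : (entropy_density nu mu) ent0 => [s| |] //; last first.
  by move=> _; rewrite gt0_muley ?leey// lte_fin mulr_gt0.
rewrite lee_fin => s0.
have [P [Pc Pd]] := coupling_exists mu_inv nu_inv (gcb_lipschitz nu_inv sE s0).
apply: le_trans Pd; apply: ereal_inf_lbound; by exists P.
Qed.

End dbar_of_gcb.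

Theorem theorem6p1 (R : realType) (S : pointedFinType) (d : nat) (hd : (1 <= d)%N)
    (mu : probability (config S d) R) (C : R)
    (mu_inv : translation_invariant mu)
    (mu_dec : asymptotically_decoupled mu)
    (hC : (0 < C)%R) :
  (forall nu : probability (config S d) R, translation_invariant nu ->
     (dbar mu nu <= sqrte ((2 * C)%:E * entropy_density nu mu))%E)
  <-> thermodynamic_gcb mu C.
Proof.
have [g [c [c0 g_cvg c_cvg dec]]] := mu_dec.
have dec_ub n j A B hA hB := (dec j n A B hA hB).2.
split=> [dbar_le|gcb nu nu_inv].
- exact (gcb_of_dbar mu_inv c0 g_cvg c_cvg dec_ub hC dbar_le).
- exact (dbar_of_gcb mu_inv c0 g_cvg c_cvg dec_ub hC gcb nu_inv).
Qed.
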